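(* Let $A$ be a noetherian commutative ring in which $2$ is invertible, let $n\ge1$, let $f(u)=\sum_{i=0}^na_{2n-2i}u^{2i}\in A[u]$ with $a_0=1$, let $B$ be the signed splitting ring of $f$, and let $\Delta\in A$ and $E\subset\operatorname{Spec}(A)$ be as in the context. Suppose that (a) $A$ is normal, (b) $\Delta$ is squarefree and a non-zerodivisor, (c) $E$ has codimension $\ge2$ in $\operatorname{Spec}(A)$. Then $B$ is normal.
   Context: The signed splitting ring is $B=\operatorname{SSplit}_A(f)=A[\eta_1,\dots,\eta_n]/I$, where $I$ is generated by equating coefficients in $f(u)=\prod_{i=1}^n(u^2-\eta_i^2)$, i.e. by $a_{2i}-(-1)^ie_i(\eta_1^2,\dots,\eta_n^2)$, $1\le i\le n$ ($e_i$ = elementary symmetric polynomial). Let $\tilde f(v)=\sum_{i=0}^na_{2n-2i}v^i$ (so $\tilde f(u^2)=f(u)$) and let $\tilde\Delta\in A$ be its discriminant. Put $\Delta=(-1)^n4^na_{2n}\tilde\Delta\in A$; in $B$ it equals $4^n\eta_1^2\cdots\eta_n^2\prod_{i<j}(\eta_i^2-\eta_j^2)^2$. Consider the $n+\binom n2$ equations on $\operatorname{Spec}(B)$: $\eta_i=0$ for $1\le i\le n$, and $\eta_i^2=\eta_j^2$ for $1\le i<j\le n$. Let $\bar E\subset\operatorname{Spec}(B)$ be the closed locus where at least two of these equations hold, and $E\subset\operatorname{Spec}(A)$ its image (closed since $A\to B$ is finite). An element $h$ of a normal ring $R$ is squarefree if $v_{\mathfrak p}(h)\in\{0,1\}$ for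 all height one primes $\mathfrak p$ of $R$, $v_{\mathfrak p}$ being the associated valuation. A subset of $\operatorname{Spec}(A)$ has codimension $\ge c$ if all primes it contains have height $\ge c$. *)

(* Defs.v *)
From HB Require Import structures.
From mathcomp Require Import all_boot all_order all_algebra.
From mathcomp Require Import ring.
From mathcomp Require Import boolp classical_sets.
From mathcomp Require Import mpoly.

Set Implicit Arguments.
Unset Strict Implicit.
Unset Printing Implicit Defensive.

Import GRing.Theory.
Local Open Scope classical_set_scope.
Local Open Scope quotient_scope.
Local Open Scope ring_scope.

(* ring_quotient.v only treats boolean proper ideals. Here an ideal is an      *)
(* arbitrary subset and may be the whole ring, so quotients are comPzRingType. *)
Section Ideals.
Variable R : comPzRingType.

Definition is_ideal (I : set R) : Prop :=
  [/\ I 0, (forall x y, I x -> I y -> I (x + y))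
    & (forall a x, I x -> I (a * x))].

Record ideal := Ideal {
  ideal_set :> set R;
  idealP : is_ideal ideal_set }.

Lemma is_ideal_smallest (X : set R) : is_ideal (smallest is_ideal X).
Proof.
split=> [J [[J0 _ _] _] //|x y Ix Iy J JP|a x Ix J JP].
- by case: (JP) => -[_ JD _] _; apply: JD; [apply: Ix|apply: Iy].
- by case: (JP) => -[_ _ JM] _; apply: JM; apply: Ix.
Qed.

Definition ideal_gen (X : set R) : ideal := Ideal (is_ideal_smallest X).

Definition noetherian : Prop :=
  forall I : ideal, exists s : seq R, I = ideal_gen [set` s] :> set R.

Definition is_prime (P : set R) : Prop :=
  [/\ is_ideal P, ~ P 1 & forall x y, P (x * y) -> P x \/ P y].

Record spec := Spec {
  prime_set :> set R;
  primeP : is_prime prime_set }.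

Definition height_ge (p : spec) (k : nat) : Prop :=
  exists c : nat -> spec,
    c k = p /\ forall i, (i < k)%N -> prime_set (c i) `<` prime_set (c i.+1).

Definition height_eq (p : spec) (k : nat) : Prop :=
  height_ge p k /\ ~ height_ge p k.+1.

Definition codim_ge (E : set spec) (c : nat) : Prop :=
  forall p : spec, E p -> height_ge p c.

End Ideals.

Section Comap.
Variables (R T : comPzRingType) (phi : {rmorphism R -> T}) (q : spec T).

Lemma is_prime_comap : is_prime (phi @^-1` q).
Proof.
case: (primeP q) => -[q0 qD qM] q1 qP; split=> [||x y]; first split.
- by rewrite /preimage /= rmorph0.
- by move=> x y; rewrite /preimage /= rmorphD; apply: qD.
- by move=> a x; rewrite /preimage /= rmorphM; apply: qM.
- by rewrite /preimage /= rmorph1.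
- by rewrite /preimage /= rmorphM; apply: qP.
Qed.

Definition comap : spec R := Spec is_prime_comap.

End Comap.

Section IdealQuotient.
Variables (R : comPzRingType) (I : ideal R).

Definition ideal_pred : {pred R} := [pred x | `[< ideal_set I x >]].

Lemma ideal_predP : zmod_closed ideal_pred.
Proof.
case: (idealP I) => I0 ID IM; split=> [|x y]; first exact/asboolP.
move=> /asboolP Ix /asboolP Iy; apply/asboolP; apply: ID => //.
by rewrite -mulN1r; apply: IM.
Qed.

HB.instance Definition _ := GRing.isZmodClosed.Build R ideal_pred ideal_predP.

Definition quo : Type := {ideal_quot ideal_pred}.
HB.instance Definition _ := GRing.Zmodule.on quo.
HB.instance Definition _ := EqQuotient.on quo.

Lemma quo_eqE (x y : R) : \pi_quo x = \pi_quo y <-> ideal_set I (x - y).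
Proof.
have E : (x - y \in ideal_pred) = (\pi_quo x == \pi_quo y).
  exact: Quotient.idealrBE.
split=> [/eqP|Ixy]; last apply/eqP; rewrite -E; first by move/asboolP.
exact/asboolP.
Qed.

Definition quo_one : quo := \pi_quo 1.
Definition quo_mul (x y : quo) : quo := \pi_quo (repr x * repr y).

Lemma quo_piM (x y : R) : \pi_quo (x * y) = quo_mul (\pi_quo x) (\pi_quo y).
Proof.
apply/quo_eqE; case: (idealP I) => _ ID IM.
have Er z : ideal_set I (z - repr (\pi_quo z)) by apply/quo_eqE; rewrite reprK.
have -> : x * y - repr (\pi_quo x) * repr (\pi_quo y) =
  x * (y - repr (\pi_quo y)) + repr (\pi_quo y) * (x - repr (\pi_quo x)).
  by ring.
by apply: ID; apply: IM.
Qed.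

Lemma quo_piD (x y : R) : \pi_quo (x + y) = (\pi_quo x : quo) + \pi_quo y.
Proof. exact: (@Quotient.pi_add _ ideal_pred). Qed.

Lemma quo_mulA : associative quo_mul.
Proof.
elim/quotW=> x; elim/quotW=> y; elim/quotW=> z.
by rewrite -(quo_piM y z) -(quo_piM x y) -(quo_piM x) -(quo_piM _ z) mulrA.
Qed.

Lemma quo_mulC : commutative quo_mul.
Proof.
by elim/quotW=> x; elim/quotW=> y; rewrite -(quo_piM x y) -(quo_piM y x) mulrC.
Qed.

Lemma quo_mul1 : left_id quo_one quo_mul.
Proof. by elim/quotW=> x; rewrite -(quo_piM 1 x) mul1r. Qed.

Lemma quo_mulDl : left_distributive quo_mul +%R.
Proof.
elim/quotW=> x; elim/quotW=> y; elim/quotW=> z.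
rewrite -(quo_piD x y) -(quo_piM x z) -(quo_piM y z) -(quo_piM _ z).
by rewrite -quo_piD mulrDl.
Qed.

HB.instance Definition _ := GRing.Zmodule_isComPzRing.Build quo
  quo_mulA quo_mulC quo_mul1 quo_mulDl.

Definition quo_map (x : R) : quo := \pi_quo x.

Lemma quo_map_zmod : zmod_morphism quo_map.
Proof.
move=> x y; apply/(addIr (quo_map y)); rewrite subrK.
by rewrite /quo_map -quo_piD subrK.
Qed.

Lemma quo_map_monoid : monoid_morphism quo_map.
Proof. by split=> // x y; apply: quo_piM. Qed.

HB.instance Definition _ := GRing.isZmodMorphism.Build R quo quo_map quo_map_zmod.
HB.instance Definition _ :=
  GRing.isMonoidMorphism.Build R quo quo_map quo_map_monoid.

End IdealQuotient.

(* 0 is excluded so that localizations are nonzero rings, to which             *)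
(* integralOver applies.                                                       *)
Record mulset (R : comPzRingType) := MulSet {
  mulset_set :> set R;
  mulset1 : mulset_set 1;
  mulsetM : forall x y, mulset_set x -> mulset_set y -> mulset_set (x * y);
  mulset0 : ~ mulset_set 0 }.

Section Localization.
Variables (R : comPzRingType) (S : mulset R).

Definition prefrac : Type := (R * {s : R | `[< mulset_set S s >]})%type.
HB.instance Definition _ := Choice.on prefrac.

Definition num (x : prefrac) : R := x.1.
Definition den (x : prefrac) : R := val x.2.

Lemma denP x : mulset_set S (den x). Proof. exact/asboolP/(valP x.2). Qed.

Definition mkfrac (a s : R) (Ss : mulset_set S s) : prefrac :=
  (a, exist _ s (asboolT Ss)).

Definition frac_equiv : rel prefrac := fun x y =>
  `[< exists2 u, mulset_set S u & u * (num x * den y - num y * den x) = 0 >].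

Lemma frac_equivP : equiv_class_of frac_equiv.
Proof.
split=> [x|x y|y x z].
- by apply/asboolP; exists 1; [exact: mulset1|rewrite subrr mulr0].
- by apply/asboolP/asboolP => -[u Su Eu]; exists u => //;
    rewrite -opprB mulrN Eu oppr0.
- move=> /asboolP[u Su Eu] /asboolP[v Sv Ev]; apply/asboolP.
  exists (u * v * den y); first by do 2?apply: mulsetM => //; exact: denP.
  have -> : u * v * den y * (num x * den z - num z * den x) =
    v * den z * (u * (num x * den y - num y * den x)) +
    u * den x * (v * (num y * den z - num z * den y)) by ring.
  by rewrite Eu Ev !mulr0 addr0.
Qed.

Canonical frac_equiv_equiv := EquivRelPack frac_equivP.
Canonical frac_equiv_encModRel := defaultEncModRel frac_equiv.

Definition loc : Type := {eq_quot frac_equiv}.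
HB.instance Definition _ := Choice.on loc.
HB.instance Definition _ := EqQuotient.on loc.

Lemma loc_eqE (x y : prefrac) : \pi_loc x = \pi_loc y <->
  exists2 u, mulset_set S u & u * (num x * den y - num y * den x) = 0.
Proof.
split=> [/eqP|H]; last apply/eqP; rewrite piE /frac_equiv.
- by move/asboolP.
- exact/asboolP.
Qed.

Lemma loc_eq1 (x y : prefrac) :
  num x * den y = num y * den x -> \pi_loc x = \pi_loc y.
Proof.
by move=> E; apply/loc_eqE; exists 1; [exact: mulset1|rewrite E subrr mulr0].
Qed.

Definition frac_add (x y : prefrac) : prefrac :=
  mkfrac (num x * den y + num y * den x) (mulsetM (denP x) (denP y)).
Definition frac_mul (x y : prefrac) : prefrac :=
  mkfrac (num x * num y) (mulsetM (denP x) (denP y)).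
Definition frac_opp (x : prefrac) : prefrac := mkfrac (- num x) (denP x).

Definition loc_zero : loc := \pi_loc (mkfrac 0 (mulset1 S)).
Definition loc_one : loc := \pi_loc (mkfrac 1 (mulset1 S)).
Definition loc_add (x y : loc) : loc := \pi_loc (frac_add (repr x) (repr y)).
Definition loc_mul (x y : loc) : loc := \pi_loc (frac_mul (repr x) (repr y)).
Definition loc_opp (x : loc) : loc := \pi_loc (frac_opp (repr x)).

Lemma loc_repr x : exists2 u, mulset_set S u &
  u * (num x * den (repr (\pi_loc x)) - num (repr (\pi_loc x)) * den x) = 0.
Proof. by apply/loc_eqE; rewrite reprK. Qed.

Lemma loc_piD x y : loc_add (\pi_loc x) (\pi_loc y) = \pi_loc (frac_add x y).
Proof.
apply/esym/loc_eqE; have [u Su Eu] := loc_repr x; have [v Sv Ev] := loc_repr y.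
move: Eu Ev; set x' := repr _; set y' := repr _ => Eu Ev.
exists (u * v); first exact: mulsetM.
transitivity (v * den y * den y' * (u * (num x * den x' - num x' * den x)) +
    u * den x * den x' * (v * (num y * den y' - num y' * den y))).
  by rewrite /frac_add /frac_mul /frac_opp /mkfrac /num /den /=; ring.
by rewrite Eu Ev !mulr0 addr0.
Qed.

Lemma loc_piM x y : loc_mul (\pi_loc x) (\pi_loc y) = \pi_loc (frac_mul x y).
Proof.
apply/esym/loc_eqE; have [u Su Eu] := loc_repr x; have [v Sv Ev] := loc_repr y.
move: Eu Ev; set x' := repr _; set y' := repr _ => Eu Ev.
exists (u * v); first exact: mulsetM.
transitivity (v * num y * den y' * (u * (num x * den x' - num x' * den x)) +
    u * den x * num x' * (v * (num y * den y' - num y' * den y))).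
  by rewrite /frac_add /frac_mul /frac_opp /mkfrac /num /den /=; ring.
by rewrite Eu Ev !mulr0 addr0.
Qed.

Lemma loc_piN x : loc_opp (\pi_loc x) = \pi_loc (frac_opp x).
Proof.
apply/esym/loc_eqE; have [u Su Eu] := loc_repr x.
move: Eu; set x' := repr _ => Eu; exists u => //.
transitivity (- (u * (num x * den x' - num x' * den x))).
  by rewrite /frac_add /frac_mul /frac_opp /mkfrac /num /den /=; ring.
by rewrite Eu oppr0.
Qed.

Local Ltac locring := apply: loc_eq1;
  rewrite /frac_add /frac_mul /frac_opp /mkfrac /num /den /=; ring.

Lemma loc_addA : associative loc_add.
Proof.
elim/quotW=> x; elim/quotW=> y; elim/quotW=> z.
rewrite (loc_piD y z) (loc_piD x y) (loc_piD x) (loc_piD _ z); locring.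
Qed.

Lemma loc_addC : commutative loc_add.
Proof.
by elim/quotW=> x; elim/quotW=> y; rewrite (loc_piD x y) (loc_piD y x); locring.
Qed.

Lemma loc_add0 : left_id loc_zero loc_add.
Proof. by elim/quotW=> x; rewrite (loc_piD _ x); locring. Qed.

Lemma loc_addN : left_inverse loc_zero loc_opp loc_add.
Proof. by elim/quotW=> x; rewrite (loc_piN x) (loc_piD _ x); locring. Qed.

Lemma loc_mulA : associative loc_mul.
Proof.
elim/quotW=> x; elim/quotW=> y; elim/quotW=> z.
rewrite (loc_piM y z) (loc_piM x y) (loc_piM x) (loc_piM _ z); locring.
Qed.

Lemma loc_mulC : commutative loc_mul.
Proof.
by elim/quotW=> x; elim/quotW=> y; rewrite (loc_piM x y) (loc_piM y x); locring.
Qed.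

Lemma loc_mul1 : left_id loc_one loc_mul.
Proof. by elim/quotW=> x; rewrite (loc_piM _ x); locring. Qed.

Lemma loc_mulDl : left_distributive loc_mul loc_add.
Proof.
elim/quotW=> x; elim/quotW=> y; elim/quotW=> z.
rewrite (loc_piD x y) (loc_piM _ z) (loc_piM x z) (loc_piM y z) loc_piD.
locring.
Qed.

Lemma loc_one_neq0 : loc_one != loc_zero.
Proof.
apply/eqP => /loc_eqE[u Su]; rewrite /num /den /=.
by rewrite mul1r mul0r subr0 mulr1 => u0; apply: (@mulset0 _ S); rewrite -u0.
Qed.

HB.instance Definition _ := GRing.isZmodule.Build loc
  loc_addA loc_addC loc_add0 loc_addN.
HB.instance Definition _ := GRing.Zmodule_isComNzRing.Build loc
  loc_mulA loc_mulC loc_mul1 loc_mulDl loc_one_neq0.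

Definition loc_map (a : R) : loc := \pi_loc (mkfrac a (mulset1 S)).

Lemma loc_map_zmod : zmod_morphism loc_map.
Proof.
move=> x y; apply/(addIr (loc_map y)); rewrite subrK.
apply: etrans (loc_piD _ _) _; locring.
Qed.

Lemma loc_map_monoid : monoid_morphism loc_map.
Proof. by split=> // x y; apply/esym/(etrans (loc_piM _ _)); locring. Qed.

HB.instance Definition _ := GRing.isZmodMorphism.Build R loc loc_map loc_map_zmod.
HB.instance Definition _ :=
  GRing.isMonoidMorphism.Build R loc loc_map loc_map_monoid.

End Localization.

Section LocalizationAtPrime.
Variables (R : comPzRingType) (p : spec R).

Lemma prime_compl1 : (~` p) 1. Proof. by case: (primeP p). Qed.
Lemma prime_complM x y : (~` p) x -> (~` p) y -> (~` p) (x * y).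
Proof. by case: (primeP p) => _ _ pP px py /pP[]. Qed.
Lemma prime_compl0 : ~ (~` p) 0.
Proof. by case: (primeP p) => -[p0 _ _] _ _; apply. Qed.

Definition prime_compl : mulset R :=
  MulSet prime_compl1 prime_complM prime_compl0.

Definition loc_at : comNzRingType := loc prime_compl.

End LocalizationAtPrime.

Section TotalFractions.
Variable D : comNzRingType.

Lemma regular1 : GRing.lreg (1 : D). Proof. exact: lreg1. Qed.
Lemma regularM (x y : D) : GRing.lreg x -> GRing.lreg y -> GRing.lreg (x * y).
Proof. exact: lregM. Qed.
Lemma regular0 : ~ GRing.lreg (0 : D).
Proof. by move/lreg_neq0; rewrite eqxx. Qed.

Definition regulars : mulset D :=
  @MulSet _ [set x : D | GRing.lreg x] regular1 regularM regular0.

(* for a domain, its field of fractions                                        *)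
Definition total_frac : comNzRingType := loc regulars.

Definition normal_domain : Prop :=
  GRing.integral_domain_axiom D /\
  forall x : total_frac, integralOver (@loc_map D regulars) x ->
    exists d : D, x = loc_map regulars d.

End TotalFractions.

Section Normality.
Variable R : comPzRingType.

Definition normal_ring : Prop := forall p : spec R, normal_domain (loc_at p).

(* v_p(h) = k, for R_p a discrete valuation ring: h is a unit of R_p times     *)
(* the k-th power of a generator of the maximal ideal p R_p                    *)
Definition valuation_eq (p : spec R) (h : R) (k : nat) : Prop :=
  exists pi u : loc_at p,
    [/\ ideal_gen [set pi] = ideal_gen (loc_map (prime_compl p) @` p)
          :> set (loc_at p),
        exists v, u * v = 1
      & loc_map (prime_compl p) h = u * pi ^+ k].

Definition squarefree (h : R) : Prop :=
  forall p : spec R, height_eq p 1 -> valuation_eq p h 0 \/ valuation_eq p h 1.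

End Normality.

(* For p monic. With mathcomp's sign convention, resultant r p is the product  *)
(* of r over the roots of p when p is monic (the Sylvester rows list           *)
(* coefficients in increasing degree), whatever the degree of r. Hence this is *)
(* \prod_(i < j) (x_i - x_j) ^+ 2 for p = \prod_i ('X - x_i%:P), also when     *)
(* size p^`() < (size p).-1.                                                   *)
Definition discriminant (R : comNzRingType) (p : {poly R}) : R :=
  (-1) ^+ 'C((size p).-1, 2) * resultant p^`() p.

Section SignedSplitting.
Variables (A : comNzRingType) (n : nat).

Section Coefficients.
Variable a : nat -> A.

Definition tilde_poly : {poly A} :=
  \sum_(i < n.+1) a (2 * n - 2 * i)%N *: 'X^i.

Definition Delta : A :=
  (-1) ^+ n * 4%:R ^+ n * a (2 * n)%N * discriminant tilde_poly.

End Coefficients.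

Variable f : {poly A}.

Definition splitting_ideal : ideal {mpoly A[n]} :=
  ideal_gen (range (fun k : nat =>
    (map_poly (@mpolyC n A) f - \prod_(i < n) ('X^2 - (('X_i) ^+ 2)%:P))`_k)).

Definition SSplit : comPzRingType := quo splitting_ideal.

Definition SSplit_map : {rmorphism A -> SSplit} :=
  (quo_map splitting_ideal \o @mpolyC n A).

Definition eta (i : 'I_n) : SSplit := quo_map splitting_ideal 'X_i.

Definition branch_index : Type :=
  ('I_n + {ij : 'I_n * 'I_n | (ij.1 < ij.2)%N})%type.
HB.instance Definition _ := Equality.on branch_index.

(* the difference of the two sides of each equation                            *)
Definition branch_eqn (e : branch_index) : SSplit :=
  match e with
  | inl i => eta i
  | inr ij => eta (val ij).1 ^+ 2 - eta (val ij).2 ^+ 2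
  end.

Definition branch_locus : set (spec SSplit) :=
  [set q | exists e1 e2 : branch_index,
     [/\ e1 != e2, prime_set q (branch_eqn e1) & prime_set q (branch_eqn e2)]].

Definition branch_image : set (spec A) := comap SSplit_map @` branch_locus.

End SignedSplitting.

(* Main.v *)
Require Import Defs.
From HB Require Import structures.
From mathcomp Require Import all_boot all_order all_algebra all_field.
From mathcomp Require Import ring.
From mathcomp Require Import boolp classical_sets.
From mathcomp Require Import mpoly ssrcomplements.

(* Write f(u) = prod_i (u^2 - x_i^2) in B, V = prod_(i < j) (x_i^2 - x_j^2),    *)
(* and let L be the A-linear functional on A[u] taking g to the coefficient of  *)
(* 1/u in the expansion of g / f at infinity; it kills (f). The functional      *)
(* h |-> L^(tensor n) (V h) kills the splitting ideal, hence gives an A-linear  *)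
(* map d : B -> A. The polynomial                                               *)
(*     Theta(x, y) = prod_j ((x_j + y_j) prod_(i < j) (y_j^2 - x_i^2))          *)
(* provides dual bases for d: z = sum_m Theta_m(x) d(y^m z) for all z in B.     *)
(* Thus a fraction z of B lies in B as soon as all the d(y^m z) lie in A. Over  *)
(* a field where f splits, partial fractions give                               *)
(*     d(z) = sum_s +- s(z) / sqrt(+- Delta),                                   *)
(* s running through the signed permutations of the roots. So if z is integral  *)
(* then Delta d(z)^2 is integral, hence in A; as A is normal and Delta is       *)
(* squarefree, d(z) is in A.                                                    *)

Set Implicit Arguments.
Unset Strict Implicit.
Unset Printing Implicit Defensive.

Import GRing.Theory.
Local Open Scope classical_set_scope.
Local Open Scope quotient_scope.
Local Open Scope ring_scope.

(** Normality is checked at one prime q of B at a time, over the prime p of A below it. The fraction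
    field of the normal domain A_p embeds into a field K where [ft], the polynomial with f(u) =
    ft(u^2), splits with roots w_i^2 ([prime_fraction_field], [splitting_field_sq]). Delta is a
    non-zerodivisor, so it stays nonzero in K, and the signed permutations of the w_i give
    evaluations B -> K.

    The form d above is [pairing]. By [pairing_reproducing] an element of B is recovered from its
    pairings with monomials, so divisibility by an element of A, and vanishing, can be tested on
    pairings, locally in A_p. By [pairing_roots] and [kappa_sq] a pairing is a sum over the
    evaluations with coefficients of square +-1/Delta. Hence for an integral fraction with
    denominator in A, each pairing x has Delta x^2 integral over A. Normality and squarefreeness
    then put x in A_p ([in_loc_squarefree]): a failure would show at a height one prime P, where
    v_P(x) < 0 and v_P(Delta) <= 1 make v_P(Delta x^2) negative. So integral fractions with
    denominator in A lie in B locally at p.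

    It remains to reach arbitrary denominators and to see that B_q is a domain
    ([normal_domain_idempotent]). The vanishing test makes every element b of B satisfy c b = b^2 w
    locally, with c in A nonzero in A_p; the resulting idempotents are integral, hence lie in B over
    A_p, and in the local ring B_q they become 0 or 1. *)

Lemma expr_split_ord (R : pzSemiRingType) (x : R) m (i : 'I_m.+1) :
  x ^+ m = x ^+ i * x ^+ (m - i).
Proof. by rewrite -exprD subnKC // -ltnS. Qed.

Lemma homogenize_term (T : comPzRingType) m (i : 'I_m.+1) (c u x y : T) :
  c * u * (x * y) ^+ i * y ^+ (m - i) = u * y ^+ m * (c * x ^+ i).
Proof. by rewrite exprMn (expr_split_ord y i); ring. Qed.

Lemma horner_map_poly_sum (R S : nzRingType) (h : {rmorphism R -> S}) m
    (E : nat -> R) x :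
  (map_poly h (\poly_(i < m) E i)).[x] = \sum_(i < m) h (E i) * x ^+ i.
Proof.
rewrite poly_def rmorph_sum horner_sum; apply: eq_bigr => i _.
by rewrite /= map_polyZ map_polyXn hornerZ hornerXn.
Qed.

(** * Normality of the localizations, in terms of fractions *)

Section LocalizationFacts.
Variables (R : comPzRingType) (S : mulset R).
Implicit Types (a s : R) (x : loc S).

Lemma loc_map_eq0 a : loc_map S a = 0 <-> exists2 s, mulset_set S s & s * a = 0.
Proof.
split=> [/(@loc_eqE _ S)[u Su]|[u Su E]].
  by rewrite /num /den /= mul0r subr0 mulr1 => E; exists u.
by apply/(@loc_eqE _ S); exists u; rewrite // /num /den /= mul0r subr0 mulr1.
Qed.

Lemma loc_map_inv s : mulset_set S s -> exists v : loc S, loc_map S s * v = 1.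
Proof.
move=> Ss; exists (\pi_(loc S) (mkfrac 1 Ss)).
apply/(etrans (loc_piM _ _))/(@loc_eq1 _ S _ (mkfrac 1 (mulset1 S))).
by rewrite /frac_mul /mkfrac /num /den /= !(mul1r, mulr1).
Qed.

Lemma loc_fracP x : exists a, exists2 s, mulset_set S s & x * loc_map S s = loc_map S a.
Proof.
elim/quotW: x => x; exists (num x); exists (den x); first exact: denP.
apply/(etrans (loc_piM _ _))/(@loc_eq1 _ S).
by rewrite /frac_mul /mkfrac /num /den /= !(mul1r, mulr1).
Qed.

Lemma loc_common_den (h : nat -> loc S) m : exists (g : nat -> R), exists2 s,
  mulset_set S s & forall i, (i < m)%N -> h i * loc_map S s = loc_map S (g i).
Proof.
elim: m => [|m [g [s Ss gE]]]; first by exists (fun=> 0), 1 => //; exact: mulset1.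
have [a [t St aE]] := loc_fracP (h m).
exists (fun i => if (i < m)%N then t * g i else s * a), (s * t).
  exact: mulsetM.
move=> i; rewrite ltnS leq_eqVlt => /predU1P[->|im].
  by rewrite ltnn !rmorphM /= -aE; ring.
by rewrite im !rmorphM /= -gE //; ring.
Qed.

End LocalizationFacts.

Section LocalKernel.
Variables (R : comPzRingType) (p : spec R).

(** The kernel of the map from R to R_p, phrased inside R. *)
Definition locker (a : R) : Prop := exists2 s, ~ prime_set p s & s * a = 0.

Lemma spec0 : prime_set p 0. Proof. by case: (Defs.primeP p) => -[]. Qed.
Lemma specD x y : prime_set p x -> prime_set p y -> prime_set p (x + y).
Proof. by case: (Defs.primeP p) => -[] _ + _ _ _; apply. Qed.
Lemma specMl a x : prime_set p x -> prime_set p (a * x).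
Proof. by case: (Defs.primeP p) => -[] _ _ + _ _; apply. Qed.
Lemma specMr a x : prime_set p x -> prime_set p (x * a).
Proof. by rewrite mulrC; apply: specMl. Qed.
Lemma specN x : prime_set p x -> prime_set p (- x).
Proof. by rewrite -mulN1r; apply: specMl. Qed.
Lemma spec1 : ~ prime_set p 1. Proof. by case: (Defs.primeP p). Qed.
Lemma specM x y : prime_set p (x * y) -> prime_set p x \/ prime_set p y.
Proof. by case: (Defs.primeP p) => _ _; apply. Qed.
Lemma nspecM x y : ~ prime_set p x -> ~ prime_set p y -> ~ prime_set p (x * y).
Proof. by move=> px py /specM[]. Qed.
Lemma nspecX x k : ~ prime_set p x -> ~ prime_set p (x ^+ k).
Proof.
move=> px; elim: k => [|k IH]; first by rewrite expr0; exact: spec1.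
by rewrite exprS; exact: nspecM.
Qed.

Lemma locker0 : locker 0. Proof. by exists 1; [exact: spec1|rewrite mulr0]. Qed.
Lemma locker_sub x : locker x -> prime_set p x.
Proof.
move=> [s ps E]; have /specM[//|//] : prime_set p (s * x) by rewrite E; exact: spec0.
Qed.
Lemma locker_cancel s x : ~ prime_set p s -> locker (s * x) -> locker x.
Proof. by move=> ps [t pt E]; exists (t * s); [exact: nspecM|rewrite -mulrA]. Qed.
Lemma locker1 : ~ locker 1. Proof. by move/locker_sub/spec1. Qed.

Lemma loc_at_eq0 x : loc_map (prime_compl p) x = 0 <-> locker x.
Proof. exact: loc_map_eq0. Qed.

(** Integrality of a / b over R_p with denominators cleared: the equation is homogenized in (a, b)
    and its leading coefficient is only a unit of R_p, so that no fraction has to be formed. *)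
Definition frac_integral (a b : R) : Prop := exists m (g : nat -> R),
  ~ prime_set p (g m) /\ locker (\sum_(i < m.+1) g i * a ^+ i * b ^+ (m - i)).

Definition local_domain : Prop :=
  forall a b, locker (a * b) -> locker a \/ locker b.

Definition local_int_closed : Prop :=
  forall a b, ~ locker b -> frac_integral a b ->
  exists e, exists2 s, ~ prime_set p s & locker (s * a - b * e).

Let D := loc_at p.
Let phi : {rmorphism R -> D} := loc_map (prime_compl p).
Let T := total_frac D.
Let psi : {rmorphism D -> T} := loc_map (regulars D).

Let psi_inj : injective psi.
Proof.
apply: raddf_inj => d /loc_map_eq0[s Ss E].
by apply: Ss; rewrite E mulr0.
Qed.

Lemma local_domainP : GRing.integral_domain_axiom D <-> local_domain.
Proof.
split=> [dom a b /loc_at_eq0|dom x y E].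
  by rewrite rmorphM => /dom/orP[]/eqP/loc_at_eq0; [left|right].
have [a [s Ss aE]] := loc_fracP x; have [b [t St bE]] := loc_fracP y.
have [v vE] := loc_map_inv Ss; have [w wE] := loc_map_inv St.
have xE : x = phi a * v by rewrite -[x]mulr1 -vE mulrA aE.
have yE : y = phi b * w by rewrite -[y]mulr1 -wE mulrA bE.
have : locker a \/ locker b.
  by apply/dom/loc_at_eq0; rewrite rmorphM /= -aE -bE mulrACA E mul0r.
by case=> /loc_at_eq0 F; rewrite ?xE ?yE /phi /= F mul0r eqxx ?orbT.
Qed.

Let phi_reg b : local_domain -> ~ locker b -> GRing.lreg (phi b).
Proof.
move=> /local_domainP dom bN x y E; apply/eqP; rewrite -subr_eq0.
have : phi b * (x - y) = 0 by rewrite mulrBr E subrr.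
by move/dom/orP => -[/eqP/loc_at_eq0|].
Qed.

(** This trades the two successive localizations in [normal_domain] (at p, then at the regular
    elements) for conditions on elements of R; the proof only clears or reintroduces
    denominators. *)
Lemma normal_domain_locP :
  normal_domain (loc_at p) <-> local_domain /\ local_int_closed.
Proof.
split=> [[dom clo]|[dom clo]]; split; try exact/local_domainP.
  move=> a b bN [m [g [gm rel]]].
  have breg : GRing.lreg (phi b) by exact/phi_reg/bN/local_domainP.
  have [beta betaE] := loc_map_inv (S := regulars D) breg.
  have [v vE] := loc_map_inv (S := prime_compl p) gm.
  have [x xb] : exists x, x * psi (phi b) = psi (phi a).
    by exists (psi (phi a) * beta); rewrite -mulrA [beta * _]mulrC betaE mulr1.
  have [|d dE] := clo x.
    exists (\poly_(i < m.+1) (v * phi (g i))).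
      have lead1 : v * phi (g m) = 1 by rewrite mulrC.
      by rewrite monicE lead_coef_poly //= lead1 ?oner_neq0.
    rewrite rootE horner_map_poly_sum; apply/eqP.
    rewrite -[LHS]mulr1 -(expr1n _ m) -betaE exprMn mulrA.
    have -> : (\sum_(i < m.+1) psi (v * phi (g i)) * x ^+ i) * psi (phi b) ^+ m =
       psi (v * phi (\sum_(i < m.+1) g i * a ^+ i * b ^+ (m - i))).
      rewrite rmorphM rmorph_sum /= rmorph_sum mulr_sumr mulr_suml.
      apply: eq_bigr => i _; rewrite !(rmorphM, rmorphXn) /=.
      by rewrite -[psi (phi a)]xb exprMn (expr_split_ord _ i) /psi /phi /=; ring.
    have E0 : phi (\sum_(i < m.+1) g i * a ^+ i * b ^+ (m - i)) = 0.
      exact/loc_at_eq0.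
    by rewrite E0 mulr0 rmorph0 mul0r.
  have [e [s Ss eE]] := loc_fracP d.
  exists e, s => //.
  apply/loc_at_eq0; rewrite raddfB /= !rmorphM /= -eE.
  apply: psi_inj; rewrite rmorph0 raddfB /= !rmorphM.
  by apply/eqP; rewrite subr_eq0 -[psi (phi a)]xb dE; apply/eqP; ring.
move=> x [P monP rootP].
have [n [d dreg nE]] := loc_fracP x.
have [a' [s Ss aE]] := loc_fracP n; have [b' [t St bE]] := loc_fracP d.
have [g [u Su gE]] := loc_common_den (S := prime_compl p) (fun i => P`_i) (size P).
(* Here x = n / d with n = a' / s and d = b' / t, so x = a / b. *)
pose a := a' * t; pose b := b' * s.
have xb : x * psi (phi b) = psi (phi a).
  rewrite /a /b !rmorphM /= /phi -aE -bE !rmorphM /= -nE; ring.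
have inj_phi s1 : ~ prime_set p s1 -> forall y, y * phi s1 = 0 -> y = 0.
  move=> /(@loc_map_inv _ (prime_compl p))[v vE] y E.
  by rewrite -[y]mulr1 -vE mulrA E mul0r.
have bN : ~ locker b.
  move=> /loc_at_eq0; rewrite rmorphM /= -bE -mulrA => E.
  have {}E : phi t * phi s = 0 by apply: dreg; rewrite mulr0.
  by have /loc_at_eq0/locker1 : phi 1 = 0 by
    rewrite rmorph1; apply: (inj_phi t St); rewrite mul1r; apply: (inj_phi s Ss).
clearbody a b.
have P0 : P != 0 by rewrite monic_neq0.
pose m := (size P).-1.
have mE : m.+1 = size P by rewrite /m prednK // lt0n size_poly_eq0.
(* P is monic, so [g m] and the common denominator [u] agree in R_p. *)
have gm : ~ prime_set p (g m).
  move=> pg; have /loc_at_eq0 : loc_map (prime_compl p) (g m - u) = 0.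
    rewrite raddfB /= -gE ?mE // /m -lead_coefE (monicP monP) mul1r subrr //.
  move/locker_sub => pgu; apply: Su; rewrite -[u](subKr (g m)).
  by apply: specD => //; exact: specN.
have [] := clo a b bN.
  exists m, g; split=> //; apply/loc_at_eq0; apply: psi_inj.
  rewrite rmorph0 rmorph_sum rmorph_sum /=.
  transitivity (psi (phi u) * psi (phi b) ^+ m * (map_poly psi P).[x]).
    rewrite horner_coef size_map_poly_id0; last first.
      by rewrite (monicP monP) rmorph1 oner_eq0.
    rewrite mulr_sumr -mE; apply: eq_bigr => i _; rewrite coef_map /=.
    rewrite !(rmorphM, rmorphXn) /= -gE -?mE // -[loc_map _ (loc_map _ a)]xb.
    rewrite rmorphM; exact: homogenize_term.
  by move/(_ =P 0): rootP => ->; rewrite mulr0.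
move=> e [s1 s1N /loc_at_eq0]; rewrite raddfB /= !rmorphM /= => /eqP.
rewrite subr_eq0 => /eqP E.
have [v vE] := loc_map_inv (S := prime_compl p) s1N.
exists (phi e * v).
have [beta betaE] := loc_map_inv (S := regulars D) (phi_reg dom bN).
have F : phi a = phi b * (phi e * v).
  rewrite mulrA -[phi b * phi e]E [_ * loc_map _ a]mulrC -mulrA vE.
  by rewrite mulr1.
by rewrite -[x]mulr1 -betaE mulrA xb F rmorphM mulrAC betaE mul1r.
Qed.

End LocalKernel.

(** * Fractions over a noetherian normal ring *)

Section Noetherian.
Variable A : comNzRingType.

Lemma ideal_gen_seqP (s : seq A) x : ideal_set (ideal_gen [set` s]) x ->
  exists c : 'I_(size s) -> A, x = \sum_k c k * s`_k.
Proof.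
pose J := [set x | exists c : 'I_(size s) -> A, x = \sum_k c k * s`_k].
move/(_ J); apply; rewrite {}/J; split=> [|y /(nthP 0)[i si <-]]; last first.
  exists (fun k => (k == Ordinal si)%:R); rewrite (bigD1 (Ordinal si)) //= eqxx.
  by rewrite mul1r big1 ?addr0 // => k /negPf ->; rewrite mul0r.
split=> [|y z [c ->] [d ->]|a y [c ->]].
- by exists (fun=> 0); rewrite big1 // => k _; rewrite mul0r.
- exists (fun k => c k + d k); rewrite -big_split; apply: eq_bigr => k _.
  by rewrite mulrDl.
- exists (fun k => a * c k); rewrite mulr_sumr; apply: eq_bigr => k _.
  by rewrite mulrA.
Qed.

(** A strictly increasing sequence of ideals would have a finitely generated union, already reached
    at a finite stage. The family is indexed so as to apply to conductors of multiples of a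
    fraction. *)
Lemma noetherian_maximal (X : Type) (F : X -> set A) (Q : X -> Prop) x0 :
  noetherian A -> (forall x, Q x -> is_ideal (F x)) -> Q x0 ->
  exists2 x, Q x & forall y, Q y -> F x `<=` F y -> F y `<=` F x.
Proof.
move=> noethA Fideal Qx0; apply: contrapT => nomax.
have next (x : {x | Q x}) :
    exists y : {x | Q x}, F (sval x) `<=` F (sval y) /\ ~ F (sval y) `<=` F (sval x).
  case: x => x Qx /=; apply: contrapT => H; apply: nomax; exists x => // y Qy xy.
  by apply: contrapT => yx; apply: H; exists (exist _ y Qy).
have [nx nxP] := choice next.
pose c k := iter k nx (exist _ x0 Qx0).
have cmono i j : (i <= j)%N -> F (sval (c i)) `<=` F (sval (c j)).
  elim: j => [|j IH]; first by rewrite leqn0 => /eqP ->.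
  rewrite leq_eqVlt => /predU1P[->//|/IH]; move/subset_trans; apply.
  by case: (nxP (c j)).
have FI k := Fideal _ (svalP (c k)).
have Uideal : is_ideal [set a | exists k, F (sval (c k)) a].
  split=> [|a b [i Fa] [j Fb]|a b [i Fb]].
  - by exists 0%N; case: (FI 0%N).
  - exists (maxn i j); case: (FI (maxn i j)) => _ + _; apply.
      exact: cmono (leq_maxl _ _) _ Fa.
    exact: cmono (leq_maxr _ _) _ Fb.
  - by exists i; case: (FI i) => _ _; apply.
have [s sE] := noethA (Ideal Uideal).
have sU a : a \in s -> exists k, F (sval (c k)) a.
  move=> sa; have : ideal_set (Ideal Uideal) a by rewrite sE => J [_ +]; apply.
  exact.
have [N sN] : exists N, forall a, a \in s -> F (sval (c N)) a.
  elim: {sE} s sU => [|a s IH] sU; first by exists 0%N.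
  have [|N HN] := IH; first by move=> b sb; apply: sU; rewrite in_cons sb orbT.
  have [k Hk] := sU a (mem_head _ _).
  exists (maxn k N) => b; rewrite in_cons => /predU1P[->|/HN Hb].
    exact: cmono (leq_maxl _ _) _ Hk.
  exact: cmono (leq_maxr _ _) _ Hb.
case: (nxP (c N)) => _; apply => a Fa.
have : ideal_set (Ideal Uideal) a by exists N.+1.
by rewrite sE; apply; split; [exact: FI|exact: sN].
Qed.

End Noetherian.

(** * Localizations of A as subrings of one field *)

Section LocalSubrings.
Variables (A : comNzRingType) (F : fieldType) (iota : {rmorphism A -> F}).
Hypotheses (noethA : noetherian A) (normA : normal_ring A).
Variable p : spec A.
Hypothesis ker_iota : forall a, iota a = 0 <-> locker p a.
Implicit Types (P : spec A) (z : F).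

(** The local ring A_P as a subset of F. For P below p the kernel of A -> A_P is that of [iota]
    ([locker_below]), so all these rings lie in one field. *)
Definition in_loc P z := exists e s, ~ prime_set P s /\ iota s * z = iota e.

Let below P := prime_set P `<=` prime_set p.

Lemma locker_below P a : below P -> locker P a <-> iota a = 0.
Proof.
move=> Pp; split=> [[s Ps E]|/ker_iota[s ps E]]; last first.
  by exists s => // /Pp.
have /eqP : iota s * iota a = 0 by rewrite -rmorphM E rmorph0.
rewrite mulf_eq0 => /orP[]/eqP // /ker_iota[t pt F0].
have /specM[/Pp//|//] : prime_set P (t * s) by rewrite F0; exact: spec0.
Qed.

Lemma iota0_below P a : below P -> iota a = 0 -> prime_set P a.
Proof. by move=> Pp /(locker_below a Pp)/locker_sub. Qed.

Lemma iota_eq_below P a b : below P -> iota a = iota b ->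
  prime_set P a -> prime_set P b.
Proof.
move=> Pp E Pa; rewrite -[b](subKr a); apply: specD => //; apply: specN.
by apply: iota0_below => //; rewrite rmorphB E subrr.
Qed.

Lemma in_locMl P s z : ~ prime_set P s -> in_loc P (iota s * z) -> in_loc P z.
Proof.
move=> Ps [e [t [Pt E]]]; exists e, (t * s); split; first exact: nspecM.
by rewrite rmorphM -mulrA.
Qed.

Lemma in_loc_integral P a b : below P -> iota b != 0 ->
  integralOver iota (iota a / iota b) -> in_loc P (iota a / iota b).
Proof.
move=> Pp b0 [Q monQ rootQ].
have [_ clo] := (normal_domain_locP P).1 (normA P).
pose m := (size Q).-1.
have mE : m.+1 = size Q by rewrite /m prednK // lt0n size_poly_eq0 monic_neq0.
have [||e [s Ps /(locker_below _ Pp)]] := clo a b.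
- by move/(locker_below _ Pp)/eqP; apply/negP.
- exists m, (fun i => Q`_i); split.
    by rewrite /m -lead_coefE (monicP monQ); exact: spec1.
  apply/(locker_below _ Pp); rewrite rmorph_sum /=.
  transitivity (iota b ^+ m * (map_poly iota Q).[iota a / iota b]); last first.
    by move/(_ =P 0): rootQ => ->; rewrite mulr0.
  rewrite horner_coef size_map_poly_id0; last first.
    by rewrite (monicP monQ) rmorph1 oner_eq0.
  rewrite mulr_sumr -mE; apply: eq_bigr => i _; rewrite coef_map /=.
  rewrite !(rmorphM, rmorphXn) (expr_split_ord (iota b) i) expr_div_n /=.
  by field; rewrite expf_neq0.
rewrite rmorphB !rmorphM /= => /eqP; rewrite subr_eq0 => /eqP E.
by exists e, s; split=> //; rewrite mulrA E mulrC mulKf.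
Qed.

(* Cayley-Hamilton: the fraction is an eigenvalue of a matrix over A. *)
Lemma in_loc_stable P (J : ideal A) a b x0 : below P -> iota b != 0 ->
  ideal_set J x0 -> iota x0 != 0 ->
  (forall x, ideal_set J x -> exists y s,
     [/\ ideal_set J y, ~ prime_set P s
       & iota s * (iota a / iota b) * iota x = iota y]) ->
  in_loc P (iota a / iota b).
Proof.
move=> Pp b0 Jx0 x00 stab; set z := _ / _.
have [g gE] := noethA J; pose r := size g.
have gJ (k : 'I_r) : ideal_set J g`_k.
  by rewrite gE => I [_]; apply; exact: mem_nth.
have rows (k : 'I_r) : exists sc : A * ('I_r -> A), ~ prime_set P sc.1 /\
    iota sc.1 * z * iota g`_k = \sum_j iota (sc.2 j) * iota g`_j.
  have [y [s [Jy Ps E]]] := stab _ (gJ k).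
  move: Jy; rewrite gE => /ideal_gen_seqP[c cE].
  exists (s, c); split=> //=; rewrite E cE rmorph_sum.
  by apply: eq_bigr => j _; rewrite rmorphM.
have [sc scP] := choice rows.
pose sigma := \prod_k (sc k).1.
have Psigma : ~ prime_set P sigma.
  apply: (big_ind (fun x => ~ prime_set P x)) => [|x y|k _].
  - exact: spec1.
  - exact: nspecM.
  - by case: (scP k).
(* Scaling column k by the other denominators gives all columns the denominator [sigma], so the row
   of generators is an eigenvector of M for [sigma * z]. *)
pose M : 'M[A]_r := \matrix_(j, k) (\prod_(l | l != k) (sc l).1 * (sc k).2 j).
apply: (in_locMl Psigma).
have sE : iota sigma * z = iota (sigma * a) / iota b by rewrite rmorphM mulrA.
rewrite sE; apply: in_loc_integral => //; rewrite -sE.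
exists (char_poly M); first exact: char_poly_monic.
rewrite map_char_poly -eigenvalue_root_char.
apply/eigenvalueP; exists (\row_k iota g`_k).
  apply/rowP => k; rewrite !mxE.
  transitivity (\sum_j iota (\prod_(l | l != k) (sc l).1) *
      (iota ((sc k).2 j) * iota g`_j)).
    by apply: eq_bigr => j _; rewrite !mxE rmorphM /=; ring.
  rewrite -mulr_sumr; case: (scP k) => _ <-.
  by rewrite /sigma [X in _ = iota X * _ * _](bigD1 k) //= rmorphM /=; ring.
apply: contra_neq x00 => v0.
move: Jx0; rewrite gE => /ideal_gen_seqP[c ->].
rewrite rmorph_sum big1 // => k _; rewrite rmorphM /=.
by have /rowP/(_ k) := v0; rewrite !mxE => ->; rewrite mulr0.
Qed.

Lemma valuation_0 P h : valuation_eq P h 0 -> ~ prime_set P h.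
Proof.
move=> [pi [u [_ [v uv] hE]]] Ph; move: hE; rewrite expr0 mulr1 => hE.
have [b [s Ps vE]] := loc_fracP v.
have /loc_at_eq0/locker_sub : loc_map (prime_compl P) (h * b - s) = 0.
  by rewrite rmorphB rmorphM /= -vE hE mulrA uv mul1r subrr.
move=> Phs; apply: Ps; rewrite -[s](subKr (h * b)); apply: specD.
  exact: specMr.
exact: specN.
Qed.

Lemma valuation_1 P h a : valuation_eq P h 1 -> prime_set P a ->
  exists e t, ~ prime_set P t /\ locker P (t * a - e * h).
Proof.
move=> [pi [u [genE [v uv]]]]; rewrite expr1 => hE Pa.
pose J := [set y : loc_at P | exists w, y = w * pi].
have : ideal_set (ideal_gen [set pi]) (loc_map (prime_compl P) a).
  by rewrite genE => I [_]; apply; exists a.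
move/(_ J) => /=; case.
  split=> [|y ->]; last by exists 1; rewrite mul1r.
  split=> [|y1 y2 [w1 ->] [w2 ->]|y1 y2 [w ->]].
  - by exists 0; rewrite mul0r.
  - by exists (w1 + w2); rewrite mulrDl.
  - by exists (y1 * w); rewrite mulrA.
move=> w aE; have [e [t Pt wE]] := loc_fracP (w * v).
exists e, t; split=> //; apply/loc_at_eq0.
rewrite rmorphB !rmorphM /= -wE hE aE; apply/eqP; rewrite subr_eq0; apply/eqP.
rewrite mulrC -[w * pi]mulr1 -uv; ring.
Qed.

Let iotaM a b : iota (a * b) = iota a * iota b. Proof. exact: rmorphM. Qed.
Let iotaD a b : iota (a + b) = iota a + iota b. Proof. exact: rmorphD. Qed.

(** If x is not in A_p, take a maximal conductor P among the multiples z = r x outside A_p; P is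
    prime and z is not in A_P. By normality z does not stabilize P, so a z is a unit of A_P for some
    a in P. Then P A_P = a A_P, and P has height one. If h is a unit at P, then z is integral over
    A_P; if h generates P A_P, then (a z)^2 is a multiple of a h z^2, so the unit a z would lie in P
    A_P. *)
Lemma in_loc_squarefree h c d : squarefree h -> iota c != 0 ->
  in_loc p (iota h * (iota d / iota c) ^+ 2) -> in_loc p (iota d / iota c).
Proof.
move=> sqf c0 hx2; set x := _ / _ in hx2 *.
apply: contrapT => xN.
pose I r := [set a | in_loc p (iota a * (iota r * x))].
pose Q r := ~ in_loc p (iota r * x).
have ppS : below p by [].
have Iideal r : Q r -> is_ideal (I r).
  move=> _; split=> [|a b [e [s [ps E]]] [e' [s' [ps' E']]]|a b [e [s [ps E]]]].
  - by exists 0, 1; split; [exact: spec1|rewrite rmorph0 mul0r mulr0].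
  - exists (s' * e + s * e'), (s * s'); split; first exact: nspecM.
    rewrite (iotaD (s' * e)) (iotaM s' e) (iotaM s e') -E -E'.
    by rewrite !(iotaD, iotaM) /=; ring.
  - exists (a * e), s; split=> //.
    by rewrite (iotaM a e) -E ?iotaM; ring.
have Q1 : Q 1 by rewrite /Q rmorph1 mul1r.
have [r Qr rmax] := noetherian_maximal noethA Iideal Q1.
pose z := iota r * x.
have zE : z = iota (r * d) / iota c by rewrite /z /x iotaM mulrA.
have Ip : I r `<=` prime_set p.
  by move=> a Ia; apply: contrapT => pa; apply: Qr; exact: in_locMl pa Ia.
have Iprime : is_prime (I r).
  split; [exact: Iideal|by move=> /Ip/spec1|move=> a b Iab].
  apply: contrapT => /not_orP[Ia Ib].
  have Qbr : Q (b * r) by rewrite /Q rmorphM -mulrA.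
  apply: Ia; apply: (rmax _ Qbr) => [y [e [s [ps E]]]|].
    exists (b * e), s; split=> //.
    by rewrite (iotaM b e) -E ?iotaM; ring.
  by move: Iab; rewrite /I /= !rmorphM -!mulrA.
pose P := Spec Iprime.
have Pp : below P by [].
have zN : ~ in_loc P z.
  move=> [e [s [Ps E]]]; apply: Ps; exists e, 1.
  by split; [exact: spec1|rewrite rmorph1 mul1r].
have Pc : prime_set P c.
  exists (r * d), 1; split; first exact: spec1.
  by rewrite rmorph1 mul1r -/z zE mulrC mulfVK.
(* otherwise z would stabilize P *)
have [a [s [w [Pa Ps Pw azE]]]] : exists a s w, [/\ prime_set P a,
    ~ prime_set P s, ~ prime_set P w & iota s * (iota a * z) = iota w].
  apply: contrapT => nounit; apply: zN; rewrite zE.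
  apply: (@in_loc_stable P (Ideal (Iideal r Qr)) (r * d) c c) => // a Pa.
  have [e [s [ps E]]] := Pa; have Ps : ~ prime_set P s by move/Pp.
  exists e, s; split=> //; last by rewrite -E -/z zE; ring.
  by apply: contrapT => Pe; apply: nounit; exists a, s, e.
have a0 : iota a != 0.
  apply: contra_not_neq Pw => a0; apply: iota0_below => //.
  by rewrite -azE a0 mul0r mulr0.
have princ b : prime_set P b -> exists e t, ~ prime_set P t /\
    iota t * iota b = iota e * iota a.
  move=> [e [u [pu E]]]; exists (e * s), (u * w); split.
    by apply: nspecM => //; move/Pp.
  by rewrite (iotaM u w) -azE (iotaM e s) -E -/z; ring.
have ker_prime : is_prime [set b | iota b = 0].
  split=> [|/=|b1 b2 /= /eqP]; first split=> [|b1 b2 /= E1 E2|b1 b2 /= E].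
  - exact: rmorph0.
  - by rewrite rmorphD E1 E2 addr0.
  - by rewrite rmorphM E mulr0.
  - by move/eqP; rewrite rmorph1 oner_eq0.
  - by rewrite rmorphM mulf_eq0 => /orP[]/eqP; [left|right].
have htP : height_eq P 1.
  split.
    exists (fun k => if k is 0 then Spec ker_prime else P); split=> // -[|//] _.
    split=> [b b0|/(_ a Pa)/=/eqP]; first exact: (iota0_below Pp b0).
    exact/negP.
  move=> [q [q2 qlt]].
  have [q01 q10] := qlt 0%N isT; have [q12 q21] := qlt 1%N isT.
  rewrite q2 in q12 q21.
  have q1p : below (q 1%N) by move=> b /q12/Pp.
  have q0p : below (q 0%N) by move=> b /q01/q1p.
  have q1a : ~ prime_set (q 1%N) a.
    move=> q1a; apply: q21 => b Pb; have [e [t [Pt E]]] := princ b Pb.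
    have : prime_set (q 1%N) (t * b).
      apply: (@iota_eq_below (q 1%N) (e * a)) => //; last exact: specMl.
      by rewrite !iotaM.
    by case/specM=> // /q12.
  (* Division by a stabilizes the prime q 1, since P A_P = a A_P and a is not in q 1. If q 1 were
     nonzero in F, this would put 1 / a in A_P although a is in P. *)
  apply: q10 => b q1b; apply: iota0_below => //; apply: contrapT => /eqP b0.
  have [q1ideal _ _] := Defs.primeP (q 1%N).
  have /= := @in_loc_stable P (Ideal q1ideal) 1 a b.
  case=> // [y q1y|].
    have [e [t [Pt E]]] := princ y (q12 _ q1y).
    exists e, t; split=> //; last first.
      by rewrite rmorph1 mul1r mulrAC E mulfK.
    have /specM[//|//] : prime_set (q 1%N) (e * a).
    apply: (@iota_eq_below (q 1%N) (t * y)) => //; last exact: specMl.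
    by rewrite !iotaM.
  move=> e [t [Pt]]; rewrite rmorph1 mul1r => E; apply: Pt.
  apply: (@iota_eq_below P (e * a)) => //; last exact: specMl.
  by rewrite iotaM -E mulfVK.
have [e2 [s2 [ps2 hz]]] : in_loc p (iota h * z ^+ 2).
  have [e [t [pt E]]] := hx2; exists (r ^+ 2 * e), t; split=> //.
  by rewrite iotaM -E rmorphXn /z /=; ring.
have Ps2 : ~ prime_set P s2 by move/Pp.
case: (sqf P htP) => [/valuation_0 Ph|/valuation_1/(_ Pa)[e [t [Pt /(locker_below _ Pp)]]]].
  have Psh : ~ prime_set P (s2 * h) by exact: nspecM.
  apply: zN; apply: (in_locMl Psh).
  have E : iota (s2 * h) * z = iota (s2 * h * (r * d)) / iota c.
    by rewrite zE !iotaM; ring.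
  rewrite E; apply: in_loc_integral => //; rewrite -E.
  (* From s2 h z^2 = e2, the square of s2 h z is s2 h e2. *)
  exists ('X^2 - (s2 * h * e2)%:P); first exact: monicXnsubC.
  rewrite rootE rmorphB /= map_polyXn map_polyC hornerD hornerN hornerXn hornerC.
  by rewrite /= [iota (_ * e2)]iotaM -hz subr_eq0 iotaM; apply/eqP; ring.
rewrite rmorphB !iotaM => /eqP; rewrite subr_eq0 => /eqP ahE.
(* Here s a z = w, t a = e h and s2 h z^2 = e2, so w^2 t s2 = s^2 a e e2 lies in P, while none of w,
   t, s2 does. *)
have : prime_set P (w ^+ 2 * t * s2).
  apply: (@iota_eq_below P (s ^+ 2 * a * e * e2)) => //.
    rewrite !iotaM -hz -azE /=.
    transitivity (iota s ^+ 2 * iota a * z ^+ 2 * iota s2 * (iota e * iota h)).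
      by ring.
    by rewrite -ahE; ring.
  by do 2!apply: specMr; exact: specMl.
by case/specM=> //; case/specM=> //; exact: nspecX.
Qed.

End LocalSubrings.

(** * The pairing on the splitting ring *)

Section TensorFunctional.
Variables (R S : comNzRingType) (f : {rmorphism R -> S}) (n : nat).
Implicit Types (lam : 'I_n -> nat -> S) (mu : nat -> S) (p : {poly R}).
Implicit Types (h : {mpoly R[n]}).

Definition poly_fun mu p : S := \sum_(i < size p) f p`_i * mu i.

Lemma poly_fun_wide mu p k : (size p <= k)%N ->
  poly_fun mu p = \sum_(i < k) f p`_i * mu i.
Proof.
move=> pk; rewrite /poly_fun (big_ord_widen _ (fun i => f p`_i * mu i) pk).
rewrite big_mkcond /=; apply: eq_bigr => i _; case: ltnP => // ip.
by rewrite nth_default // rmorph0 mul0r.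
Qed.

Lemma poly_funD mu p q : poly_fun mu (p + q) = poly_fun mu p + poly_fun mu q.
Proof.
pose k := maxn (size p) (size q).
rewrite !(@poly_fun_wide _ _ k) ?leq_maxl ?leq_maxr ?size_polyD //.
by rewrite -big_split; apply: eq_bigr => i _; rewrite coefD rmorphD mulrDl.
Qed.

Lemma poly_funZ mu c p : poly_fun mu (c *: p) = f c * poly_fun mu p.
Proof.
rewrite (@poly_fun_wide _ (c *: p) (size p)) ?size_scale_leq // mulr_sumr.
by apply: eq_bigr => i _; rewrite coefZ rmorphM mulrA.
Qed.

Lemma poly_funXn mu k : poly_fun mu 'X^k = mu k.
Proof.
rewrite /poly_fun size_polyXn big_ord_recr /= coefXn eqxx rmorph1 mul1r.
rewrite big1 ?add0r // => i _; rewrite coefXn.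
by rewrite ltn_eqF ?rmorph0 ?mul0r // ltn_ord.
Qed.

Lemma poly_funXnM mu p a : poly_fun mu (p * 'X^a) = 
  \sum_(i < size p) f p`_i * mu (i + a)%N.
Proof.
have F0 : poly_fun mu 0 = 0 by rewrite /poly_fun size_poly0 big_ord0.
rewrite -[p in LHS]coefK poly_def mulr_suml.
elim/big_rec2: _ => // i y1 y2 _ <-.
by rewrite poly_funD -scalerAl -exprD poly_funZ poly_funXn.
Qed.

(** The tensor product of the functionals [poly_fun (lam j)]. Each variable carries its own
    functional, so that they can be replaced one at a time. *)
Definition tensor_fun lam h : S :=
  \sum_(m <- msupp h) f h@_m * \prod_j lam j (m j).

Lemma tensor_fun_wide lam h k : (msize h <= k)%N ->
  tensor_fun lam h = \sum_(m : 'X_{1..n < k}) f h@_m * \prod_j lam j (m j).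
Proof.
move=> hk; rewrite /tensor_fun (big_mksub 'X_{1..n < k}) ?msupp_uniq //=.
  rewrite big_rmcond //= => j /memN_msupp_eq0 ->.
  by rewrite raddf0 mul0r.
by move=> x /msize_mdeg_lt /leq_trans; apply.
Qed.

Lemma tensor_fun_zmod lam : zmod_morphism (tensor_fun lam).
Proof.
move=> p q /=; pose k := maxn (msize (p - q)) (maxn (msize p) (msize q)).
rewrite !(@tensor_fun_wide _ _ k) ?leq_max ?leqnn ?orbT //.
rewrite -sumrB; apply: eq_bigr => m _.
by rewrite !raddfB /= mulrDl mulNr.
Qed.

HB.instance Definition _ lam := GRing.isZmodMorphism.Build {mpoly R[n]} S
  (tensor_fun lam) (tensor_fun_zmod lam).

Lemma tensor_funZX lam c m :
  tensor_fun lam (c *: 'X_[m]) = f c * \prod_j lam j (m j).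
Proof.
have [->|c0] := eqVneq c 0.
  by rewrite scale0r raddf0 rmorph0 mul0r.
rewrite /tensor_fun msuppMCX // big_seq1.
by rewrite mcoeffZ mcoeffX eqxx mulr1.
Qed.

Lemma tensor_funZ lam c h : tensor_fun lam (c *: h) = f c * tensor_fun lam h.
Proof.
elim/mpolyind: h => [|c1 m h _ _ IH]; first by rewrite scaler0 raddf0 mulr0.
rewrite scalerDr !raddfD /= IH scalerA !tensor_funZX rmorphM /=; ring.
Qed.

Lemma eq_tensor_fun lam1 lam2 h : (forall j k, lam1 j k = lam2 j k) ->
  tensor_fun lam1 h = tensor_fun lam2 h.
Proof.
by move=> E; apply: eq_bigr => m _; congr (_ * _); apply: eq_bigr => j _.
Qed.

Lemma tensor_fun0 lam j h : (forall k, lam j k = 0) -> tensor_fun lam h = 0.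
Proof.
move=> E; apply: big1 => m _.
by rewrite (bigD1 j) //= E mul0r mulr0.
Qed.

Definition polyXi (j : 'I_n) (p : {poly R}) : {mpoly R[n]} :=
  (map_poly (@mpolyC n R) p).['X_j].

(** Multiplication by a polynomial in the j-th variable alone only changes the j-th tensor
    factor. *)
Lemma tensor_fun_polyXi lam j p h : tensor_fun lam (polyXi j p * h) =
  tensor_fun (fun i k => if i == j then poly_fun (lam j) (p * 'X^k)
                         else lam i k) h.
Proof.
elim/mpolyind: h => [|c m h _ _ IH]; first by rewrite mulr0 !raddf0.
rewrite mulrDr !raddfD /= IH tensor_funZX; congr (_ + _).
rewrite /polyXi horner_coef size_map_inj_poly ?mpolyC0 //; last first.
  by move=> x y /eqP; rewrite mpolyC_eq => /eqP.
rewrite mulr_suml raddf_sum /= [X in _ = _ * X](bigD1 j) //= eqxx.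
rewrite poly_funXnM mulr_suml mulr_sumr; apply: eq_bigr => i _.
rewrite coef_map /= mul_mpolyC mpolyXn -scalerAr -scalerAl scalerA -mpolyXD.
rewrite tensor_funZX rmorphM /= (bigD1 j) //= mnmDE mulmnE mnm1E eqxx mul1n.
rewrite [X in _ * (_ * X) = _](eq_bigr (fun i => lam i (m i))) => [|i0 i0j].
  rewrite [X in _ = _ * (_ * X)](eq_bigr (fun i => lam i (m i))).
    by ring.
  by move=> i0 /negPf ->.
by rewrite mnmDE mulmnE mnm1E eq_sym (negPf i0j) mul0n.
Qed.

End TensorFunctional.

(** * The Vandermonde determinant in the squares of the variables *)

Section Vandermonde.
Variables (R : comNzRingType) (n : nat).

Definition sq_vander : {mpoly R[n]} :=
  \prod_(j < n) \prod_(i < n | (j < i)%N) ('X_j ^+ 2 - 'X_i ^+ 2).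

Lemma sq_vanderE :
  sq_vander = \det (Vandermonde n (\row_i (- ('X_i ^+ 2) : {mpoly R[n]}))).
Proof.
rewrite det_Vandermonde; apply: eq_bigr => j _; apply: eq_bigr => i _.
by rewrite !mxE opprK addrC.
Qed.

(* Cramer's rule: the values of q at n points determine its coefficients. *)
Lemma sq_vander_coef (q : {poly {mpoly R[n]}}) (l : 'I_n) : (size q <= n)%N ->
  exists c : 'I_n -> {mpoly R[n]},
    sq_vander * q`_l = \sum_i c i * q.['X_i ^+ 2].
Proof.
move=> qn; pose V := Vandermonde n (\row_i (- ('X_i ^+ 2) : {mpoly R[n]})).
pose u : 'rV_n := \row_(k < n) ((-1) ^+ k * q`_k).
have uV : u *m V = \row_i q.['X_i ^+ 2].
  apply/rowP => i; rewrite !mxE (horner_coef_wide _ qn); apply: eq_bigr => k _.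
  by rewrite !mxE [(- ('X_i ^+ 2)) ^+ k]exprNn mulrACA -expr2 sqrr_sign mul1r.
exists (fun i => (-1) ^+ l * (\adj V) i l).
have : ((u *m V) *m \adj V) 0 l = (sq_vander *: u) 0 l.
  by rewrite -mulmxA mul_mx_adj sq_vanderE mul_mx_scalar.
rewrite uV !mxE => E.
transitivity ((-1) ^+ l * (sq_vander * ((-1) ^+ l * q`_l))).
  by rewrite mulrCA signrMK.
rewrite -E mulr_sumr; apply: eq_bigr => i _; rewrite !mxE; ring.
Qed.

End Vandermonde.

(** * The residue functional and the pairing it defines *)

Section Residue.
Variables (A : comNzRingType) (n : nat) (ft : {poly A}).
Hypotheses (n_gt0 : (0 < n)%N) (ft_monic : ft \is monic).
Hypothesis size_ft : size ft = n.+1.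

Let F := ft \Po 'X^2.

Let coef_comp_sq_lead : F`_(n.*2) = 1.
Proof.
rewrite coef_comp_poly_Xn // dvdn2 odd_double divn2 doubleK.
by rewrite -[n]/(n.+1.-1) -size_ft -lead_coefE; exact/eqP.
Qed.

Lemma size_comp_sq : size F = n.*2.+1.
Proof.
apply/eqP; rewrite eqn_leq; apply/andP; split.
  apply/leq_sizeP => j jn; rewrite coef_comp_poly_Xn //; case: ifP => // dj.
  rewrite nth_default // size_ft divn2.
  by move: jn; rewrite -{1}[j](divnK dj) muln2 divn2 ltn_double.
rewrite ltnNge; apply/negP => /leq_sizeP/(_ _ (leqnn _))/eqP.
by rewrite coef_comp_sq_lead oner_eq0.
Qed.

Lemma comp_sq_monic : F \is monic.
Proof. by rewrite monicE lead_coefE size_comp_sq /= coef_comp_sq_lead. Qed.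

(* The coefficient of 1/u in the expansion of u^k / F(u) at infinity. *)
Definition residue (k : nat) : A := (Pdiv.CommonRing.rmodp 'X^k F)`_(n.*2.-1).

Lemma poly_fun_residue p :
  poly_fun idfun residue p = (Pdiv.CommonRing.rmodp p F)`_(n.*2.-1).
Proof.
rewrite -[p in RHS]coefK poly_def Pdiv.RingMonic.rmodp_sum ?comp_sq_monic //.
rewrite coef_sum; apply: eq_bigr => i _.
by rewrite Pdiv.RingMonic.rmodpZ ?comp_sq_monic // coefZ.
Qed.

Lemma residue_mull p : poly_fun idfun residue (F * p) = 0.
Proof.
by rewrite poly_fun_residue mulrC Pdiv.RingMonic.rmodp_mull ?comp_sq_monic // coef0.
Qed.

Lemma residue_small (p : {poly A}) : (size p <= n.*2)%N ->
  poly_fun idfun residue p = p`_(n.*2.-1).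
Proof.
move=> pn; rewrite poly_fun_residue Pdiv.CommonRing.rmodp_small //.
by rewrite size_comp_sq.
Qed.

(** The map d, on polynomial representatives of elements of B. *)
Definition pairing (h : {mpoly A[n]}) : A :=
  tensor_fun idfun (fun=> residue) (sq_vander A n * h).

Let comp_sqE (r : {poly {mpoly A[n]}}) x : (r \Po 'X^2).[x] = r.[x ^+ 2].
Proof. by rewrite horner_comp hornerXn. Qed.

Lemma horner_prod_XsubC (R : comNzRingType) (y : 'I_n -> R) i :
  (\prod_(j < n) ('X - (y j)%:P)).[y i] = 0.
Proof. by rewrite horner_prod (bigD1 i) //= hornerXsubC subrr mul0r. Qed.

Lemma prod_comp_sq (R : comNzRingType) (x : 'I_n -> R) :
  \prod_(i < n) ('X^2 - (x i ^+ 2)%:P) = (\prod_(i < n) ('X - (x i ^+ 2)%:P)) \Po 'X^2.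
Proof.
rewrite rmorph_prod; apply: eq_bigr => i _.
by rewrite /= comp_polyB comp_polyX comp_polyC.
Qed.

(** The ideal is generated by the coefficients of q(u^2), where q = ft - prod_i (X - X_i^2) has
    degree below n. Cramer's rule writes V times such a coefficient as a combination of the q(X_i^2)
    = F(X_i), and the residue in the i-th variable kills multiples of F(X_i). *)
Lemma pairing_splitting_ideal (h r : {mpoly A[n]}) :
  ideal_set (splitting_ideal n F) r -> pairing (r * h) = 0.
Proof.
pose J := [set r : {mpoly A[n]} | forall h, pairing (r * h) = 0].
move/(_ J) => J_r; apply: (J_r _ h); rewrite {J_r}/J; split=> [|_ [k _ <-] /= {}h].
  split=> [g|x y Jx Jy g|a x Jx g]; rewrite /pairing.
  - by rewrite mul0r mulr0 raddf0.
  - rewrite mulrDl mulrDr raddfD /=.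
    by rewrite -/(pairing _) -/(pairing _) Jx Jy addr0.
  - by rewrite [a * x]mulrC -mulrA; apply: Jx.
pose q := map_poly (@mpolyC n A) ft - \prod_(i < n) ('X - ('X_i ^+ 2)%:P).
have qn : (size q <= n)%N.
  have size1 : size (map_poly (@mpolyC n A) ft) = n.+1.
    by rewrite size_map_inj_poly ?mpolyC0 // => x y /eqP; rewrite mpolyC_eq => /eqP.
  have mon1 : map_poly (@mpolyC n A) ft \is monic by rewrite monic_map.
  have size2 : size (\prod_(i < n) ('X - ('X_i ^+ 2 : {mpoly A[n]})%:P)) = n.+1.
    by rewrite size_prod_XsubC -[index_enum _]/(index_enum _) /index_enum -enumT size_enum_ord.
  have mon2 := monic_prod_XsubC (index_enum 'I_n) xpredT (fun i => 'X_i ^+ 2 : {mpoly A[n]}).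
  apply/leq_sizeP => j; rewrite leq_eqVlt coefB => /predU1P[<-|nj].
    move: mon1 mon2; rewrite !monicE !lead_coefE size1 size2 /=.
    by move=> /eqP -> /eqP ->; rewrite subrr.
  by rewrite !nth_default ?subrr ?size1 ?size2.
have -> : map_poly (@mpolyC n A) F - \prod_(i < n) ('X^2 - (('X_i) ^+ 2)%:P) =
    q \Po 'X^2.
  by rewrite comp_polyB -prod_comp_sq /F map_comp_poly map_polyXn.
rewrite coef_comp_poly_Xn //; case: ifP => dk; last by rewrite /pairing mul0r mulr0 raddf0.
have [kn|nk] := ltnP (k %/ 2) n; last first.
  by rewrite nth_default ?(leq_trans qn) // /pairing mul0r mulr0 raddf0.
have [c cE] := sq_vander_coef (Ordinal kn) qn.
rewrite /pairing mulrA [_ * _`__]cE mulr_suml raddf_sum big1 //= => i _.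
have -> : q.['X_i ^+ 2] = polyXi i F.
  rewrite /polyXi /F map_comp_poly map_polyXn comp_sqE /q hornerD hornerN.
  by rewrite horner_prod_XsubC subr0.
rewrite mulrAC mulrC tensor_fun_polyXi; apply: (@tensor_fun0 _ _ _ _ _ i).
by move=> k1; rewrite eqxx residue_mull.
Qed.

End Residue.

(** * The reproducing formula over a ring where F splits *)

Section Reproducing.
Variables (A S : comNzRingType) (f : {rmorphism A -> S}) (n : nat).
Variables (ft : {poly A}) (x : 'I_n -> S).
Hypotheses (n_gt0 : (0 < n)%N) (ft_monic : ft \is monic).
Hypothesis size_ft : size ft = n.+1.
Let F := ft \Po 'X^2.
Hypothesis F_split :
  map_poly f F = \prod_(i < n) ('X^2 - (x i ^+ 2)%:P).

Let L : nat -> S := fun k => f (residue n ft k).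

Lemma poly_fun_map_residue (p : {poly A}) :
  poly_fun idfun L (map_poly f p) = f (poly_fun idfun (residue n ft) p).
Proof.
rewrite (poly_fun_wide _ _ (size_poly _ _)) /poly_fun rmorph_sum.
by apply: eq_bigr => i _; rewrite coef_map rmorphM.
Qed.

Let cofactor (j : 'I_n) : {poly S} :=
  ('X + (x j)%:P) * \prod_(i < n | i != j) ('X^2 - (x i ^+ 2)%:P).

Let cofactorE j : ('X - (x j)%:P) * cofactor j = map_poly f F.
Proof.
rewrite F_split (bigD1 j) //= mulrA -subr_sqr rmorphXn //.
Qed.

Let size_cofactor j : size (cofactor j) = n.*2.
Proof.
have mon : map_poly f F \is monic by exact: (monic_map f (comp_sq_monic ft_monic size_ft)).
have c0 : cofactor j != 0.
  apply/eqP => E; move: (monic_neq0 mon).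
  by rewrite -(cofactorE j) E mulr0 eqxx.
have : size (map_poly f F) = n.*2.+1.
  rewrite size_map_poly_id0; first exact: size_comp_sq.
  by rewrite /F (monicP (comp_sq_monic ft_monic size_ft)) rmorph1 oner_eq0.
by rewrite -(cofactorE j) size_monicM ?monicXsubC // size_XsubC => -[].
Qed.

Let monic_cofactor j : cofactor j \is monic.
Proof.
apply: rpredM; last by apply: rpred_prod => i _; exact: monicXnsubC.
by rewrite -[x j]opprK polyCN; exact: monicXsubC.
Qed.

(** [cofactor j] is F / (u - x_j), so this is the coefficient of 1/u in u^k / (u - x_j):
    multiplication by the cofactor turns the residue into evaluation at x_j. *)
Lemma residue_cofactor j k : poly_fun idfun L (cofactor j * 'X^k) = x j ^+ k.
Proof.
elim: k => [|k IH].
  rewrite expr0 mulr1 (poly_fun_wide _ _ (eq_leq (size_cofactor j))).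
  have -> : n.*2 = (n.*2.-1).+1 by rewrite prednK // double_gt0.
  rewrite big_ord_recr /= big1 ?add0r => [|i _].
    have := monic_cofactor j; rewrite monicE lead_coefE size_cofactor => /eqP ->.
    rewrite mul1r /L -[residue n ft _](@poly_funXn _ _ idfun).
    rewrite (residue_small ft_monic size_ft) ?size_polyXn ?prednK ?double_gt0 //.
    by rewrite coefXn eqxx rmorph1.
  rewrite /L -[residue n ft _](@poly_funXn _ _ idfun).
  rewrite (residue_small ft_monic size_ft); last first.
    by rewrite size_polyXn (leq_trans (ltn_ord i)) // leq_pred.
  by rewrite coefXn gtn_eqF ?ltn_ord // rmorph0 mulr0.
have E : cofactor j * 'X^(k.+1) =
    map_poly f (F * 'X^k) + x j *: (cofactor j * 'X^k).
  rewrite rmorphM /= map_polyXn -(cofactorE j) -mul_polyC exprS; ring.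
rewrite E poly_funD poly_funZ IH poly_fun_map_residue.
by rewrite (residue_mull ft_monic size_ft) rmorph0 add0r exprS.
Qed.

Let weight (j : 'I_n) : {mpoly S[n]} :=
  (\prod_(i < n | (i < j)%N) ('X_j ^+ 2 - (x i ^+ 2)%:MP)) * ('X_j + (x j)%:MP).
Let vfactor (j : 'I_n) : {mpoly S[n]} :=
  \prod_(i < n | (j < i)%N) ('X_j ^+ 2 - 'X_i ^+ 2).

Let tensor_fun_evaluated (lam : 'I_n -> nat -> S) i (h : {mpoly S[n]}) :
  (forall k, lam i k = x i ^+ k) ->
  tensor_fun idfun lam ('X_i ^+ 2 * h) =
  tensor_fun idfun lam ((x i ^+ 2)%:MP * h).
Proof.
move=> lamE; apply/eqP; rewrite -subr_eq0 -raddfB -mulrBl /=; apply/eqP.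
have -> : 'X_i ^+ 2 - (x i ^+ 2)%:MP = polyXi i ('X^2 - (x i ^+ 2)%:P).
  by rewrite /polyXi rmorphB /= map_polyXn map_polyC hornerD hornerN hornerXn hornerC.
rewrite tensor_fun_polyXi; apply: (@tensor_fun0 _ _ _ _ _ i) => k.
rewrite eqxx mulrBl -exprD -scaleN1r -mul_polyC poly_funD !mul_polyC.
rewrite !poly_funZ !poly_funXn !lamE /= exprD; ring.
Qed.

Let tensor_fun_vfactor (lam : 'I_n -> nat -> S) (j : 'I_n) (h : {mpoly S[n]}) :
  (forall (i : 'I_n) k, (j < i)%N -> lam i k = x i ^+ k) ->
  tensor_fun idfun lam (vfactor j * h) = tensor_fun idfun lam
    (\prod_(i < n | (j < i)%N) ('X_j ^+ 2 - (x i ^+ 2)%:MP) * h).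
Proof.
move=> lamE; rewrite /vfactor; elim: (index_enum _) h => [|i s IH] h.
  by rewrite !big_nil.
rewrite !big_cons; case: ifP => ji; last exact: IH.
rewrite -!mulrA mulrCA IH mulrCA !mulrBl !raddfB /=.
by rewrite (tensor_fun_evaluated _ (fun k => lamE i k ji)).
Qed.

Let hybrid (k : nat) (j : 'I_n) : nat -> S :=
  if (j < k)%N then L else fun a => x j ^+ a.

(** Induction from evaluation at x (k = 0) to residues in all variables (k = n). In the step the
    variables beyond j are still evaluated, so [vfactor j] becomes the product of the X_j^2 - x_i^2
    for i > j. Together with [weight j] it is the cofactor of x_j, which turns the residue in X_j
    into evaluation. *)
Lemma tensor_fun_hybrid k h : (k <= n)%N -> tensor_fun idfun (hybrid k)
  (\prod_(j < n | (j < k)%N) (weight j * vfactor j) * h) = meval x h.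
Proof.
elim: k h => [|k IH] h kn.
  by rewrite big_pred0 // mul1r mevalE /tensor_fun.
pose j := Ordinal kn.
rewrite (bigD1 j) //= -IH; last exact: ltnW.
have E : \prod_(i < n | (i < k.+1)%N && (i != j)) (weight i * vfactor i) =
         \prod_(i < n | (i < k)%N) (weight i * vfactor i).
  by apply: eq_bigl => i; rewrite ltnS ltn_neqAle andbC.
rewrite {}E; pose H := \prod_(i < n | (i < k)%N) (weight i * vfactor i) * h.
have -> : weight j * vfactor j * \prod_(i < n | (i < k)%N) (weight i * vfactor i) * h =
   vfactor j * (weight j * H) by rewrite [RHS]mulrCA /H -!mulrA.
rewrite -/H tensor_fun_vfactor; last first.
  by move=> i a ji; rewrite /hybrid ltnNge ji.
have -> : \prod_(i < n | (j < i)%N) ('X_j ^+ 2 - (x i ^+ 2)%:MP) * (weight j * H) =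
   polyXi j (cofactor j) * H.
  rewrite mulrA; congr (_ * _).
  rewrite /polyXi /cofactor rmorphM hornerM /= rmorphD /= map_polyX map_polyC.
  rewrite hornerD hornerX hornerC rmorph_prod horner_prod.
  rewrite [in RHS](bigID (fun i : 'I_n => (i < j)%N)) /=.
  have ev (i : 'I_n) :
      (map_poly (mpolyC n (R:=S)) ('X^2 - (x i ^+ 2)%:P)).['X_j] =
      'X_j ^+ 2 - (x i ^+ 2)%:MP.
    by rewrite rmorphB /= map_polyXn map_polyC hornerD hornerN hornerXn hornerC.
  rewrite !(eq_bigr _ (fun i _ => ev i)).
  rewrite [X in _ = _ * (X * _)](eq_bigl (fun i : 'I_n => (i < j)%N)); last first.
    by move=> i; rewrite -val_eqE /= ltn_neqAle; case: eqP.
  rewrite [X in _ = _ * (_ * X)](eq_bigl (fun i : 'I_n => (j < i)%N)); last first.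
    by move=> i; rewrite -leqNgt ltn_neqAle eq_sym.
  rewrite /weight; ring.
rewrite tensor_fun_polyXi; apply: eq_tensor_fun => i a.
rewrite /hybrid [(i < k.+1)%N]ltnS [(i <= k)%N]leq_eqVlt -val_eqE /=.
case: eqP => [ij|//].
have -> : i = j by exact: val_inj.
by rewrite ?eqxx ltnn /= ?ltnSn residue_cofactor.
Qed.

(** Theta(x, y) with the roots x substituted and the variables y left free. *)
Definition dual_kernel : {mpoly S[n]} := \prod_j weight j.

(** The case k = n of [tensor_fun_hybrid]: the weights multiply to Theta and the [vfactor]s to V,
    and Theta is expanded into monomials. *)
Lemma pairing_reproducing (h : {mpoly A[n]}) : mmap f x h =
  \sum_(m <- msupp dual_kernel) dual_kernel@_m * f (pairing ft ('X_[m] * h)).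
Proof.
have -> : mmap f x h = meval x (map_mpoly f h).
  elim/mpolyind: h => [|c m g _ _ IH]; first by rewrite !raddf0.
  by rewrite !raddfD /= IH mmapZ mmapX map_mpolyZ map_mpolyX mevalZ mevalX.
rewrite -(tensor_fun_hybrid _ (leqnn n)).
have -> : \prod_(j < n | (j < n)%N) (weight j * vfactor j) =
    dual_kernel * sq_vander S n.
  by rewrite -big_split /=; apply: eq_bigl => j; rewrite ltn_ord.
rewrite -mulrA {1}[dual_kernel]mpolyE mulr_suml raddf_sum /=.
apply: eq_bigr => m _; rewrite -scalerAl tensor_funZ /=; congr (_ * _).
rewrite mulrCA.
have -> : sq_vander S n * ('X_[m] * map_mpoly f h) =
    map_mpoly f (sq_vander A n * ('X_[m] * h)).
  rewrite !rmorphM /= map_mpolyX; congr (_ * _).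
  rewrite /sq_vander rmorph_prod; apply: eq_bigr => j _.
  rewrite rmorph_prod; apply: eq_bigr => i _.
  by rewrite rmorphB !rmorphXn /= !map_mpolyX.
rewrite /pairing; move: (sq_vander A n * _) => g.
elim/mpolyind: g => [|c m1 g _ _ IH]; first by rewrite !raddf0.
rewrite !raddfD /= IH map_mpolyZ map_mpolyX !tensor_funZX rmorphM; congr (_ * _ + _).
by rewrite rmorph_prod; apply: eq_bigr => j _; rewrite /hybrid ltn_ord.
Qed.

End Reproducing.

(** * The pairing over a splitting field *)

(* f may kill the leading coefficient of r (the derivative of q, below), in    *)
(* which case f does not map Sylvester matrices to Sylvester matrices.         *)
Section ResultantRoots.
Variables (R : comNzRingType) (K : fieldType) (f : {rmorphism R -> K}).
Variables (r q : {poly R}).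
Let m := (size q).-1.
Let e := (size r).-1.

Let row_up (i : 'I_m) (k : 'I_(m + e)) :
  Sylvester_mx r q (lshift e i) k = (r * 'X^i)`_k.
Proof.
rewrite Sylvester_mxE (unsplitK (inl _ i)) /= coefMXn ltnNge.
by case: leqP.
Qed.

Let row_down (i : 'I_e) (k : 'I_(m + e)) :
  Sylvester_mx r q (rshift m i) k = (q * 'X^i)`_k.
Proof.
rewrite Sylvester_mxE (unsplitK (inr _ i)) /= coefMXn ltnNge.
by case: leqP.
Qed.

Let size_row (p : {poly R}) d i : (i < d)%N ->
  (size (p * 'X^i)%R <= d + (size p).-1)%N.
Proof.
move=> id; apply: leq_trans (size_polyMleq _ _) _; rewrite size_polyXn addnS /=.
case: (size p) => [|k]; first by rewrite add0n addn0 ltnW.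
by rewrite addSn -addnS addnC leq_add2r.
Qed.

Let eval_row_up (i : 'I_m) t :
  \sum_(k < m + e) f (Sylvester_mx r q (lshift e i) k) * t ^+ k =
  (map_poly f r).[t] * t ^+ i.
Proof.
rewrite -[t ^+ i in RHS]hornerXn -hornerM -(map_polyXn f) -rmorphM /=.
rewrite (@horner_coef_wide _ (m + e)).
  by apply: eq_bigr => k _; rewrite row_up coef_map.
exact: leq_trans (size_poly _ _) (size_row _ (ltn_ord i)).
Qed.

Let eval_row_down (i : 'I_e) t :
  \sum_(k < m + e) f (Sylvester_mx r q (rshift m i) k) * t ^+ k =
  (map_poly f q).[t] * t ^+ i.
Proof.
rewrite -[t ^+ i in RHS]hornerXn -hornerM -(map_polyXn f) -rmorphM /=.
rewrite (@horner_coef_wide _ (m + e)).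
  by apply: eq_bigr => k _; rewrite row_down coef_map.
apply: leq_trans (size_poly _ _) _; rewrite addnC.
exact: size_row (ltn_ord i).
Qed.

(** The powers of a common root form a nonzero vector killed by the Sylvester matrix. *)
Lemma resultant_common_root t : (0 < m)%N -> root (map_poly f r) t ->
  root (map_poly f q) t -> f (resultant r q) = 0.
Proof.
move=> m_gt0 /eqP rt /eqP qt; apply/eqP; rewrite -det_map_mx -det_tr.
apply/det0P; exists (\row_k t ^+ k).
  have dS : (0 < m + e)%N by rewrite addn_gt0 m_gt0.
  apply/eqP => /rowP/(_ (Ordinal dS)); rewrite !mxE expr0 => /eqP.
  by rewrite oner_eq0.
apply/rowP => i; rewrite [LHS]mxE [RHS]mxE.
transitivity (\sum_(k < m + e) f (Sylvester_mx r q i k) * t ^+ k).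
  by apply: eq_bigr => k _; rewrite !mxE mulrC.
case: (split_ordP i) => j ->.
  by rewrite eval_row_up rt mul0r.
by rewrite eval_row_down qt mul0r.
Qed.

(** The first m columns of [W] list the powers of the roots. In the product with the Sylvester
    matrix the rows of q vanish on them and those of r give V diag(r(t_j)); the remaining diagonal
    block is unitriangular since q is monic. As the roots are distinct, det V cancels. *)
Lemma resultant_prod_roots n (t : 'I_n -> K) : size q = n.+1 -> q \is monic ->
  injective t -> (forall i, root (map_poly f q) (t i)) ->
  f (resultant r q) = \prod_i (map_poly f r).[t i].
Proof.
move=> size_q; have nm : n = m by rewrite /m size_q.
move: t; rewrite {}nm => t q_monic t_inj qt; pose V := Vandermonde m (\row_i t i).
have q0 : (0 < size q)%N by rewrite size_poly_gt0 monic_neq0.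
have V0 : \det V != 0.
  rewrite det_Vandermonde; apply/prodf_neq0 => i _; apply/prodf_neq0 => j ij.
  rewrite !mxE subr_eq0; apply: contraTneq ij => /t_inj ->.
  by rewrite ltnn.
pose S := map_mx f (Sylvester_mx r q).
pose W : 'M[K]_(m + e) :=
  block_mx V 0 (\matrix_(i, j) t j ^+ (m + i)) (1%:M).
have detW : \det W = \det V by rewrite det_lblock det1 mulr1.
have SWl i j : (S *m W) i (lshift e j) = \sum_(k < m + e) S i k * t j ^+ k.
  rewrite !mxE; apply: eq_bigr => k _; congr (_ * _).
  case: (split_ordP k) => l ->; rewrite ?block_mxEul ?block_mxEdl !mxE //.
have ulE : ulsubmx (S *m W) = V *m diag_mx (\row_j (map_poly f r).[t j]).
  apply/matrixP => i j; rewrite mul_mx_diag 2![LHS]mxE SWl !mxE mulrC -eval_row_up.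
  by apply: eq_bigr => k _; rewrite mxE.
have dlE : dlsubmx (S *m W) = 0.
  apply/matrixP => i j; rewrite 2![LHS]mxE SWl mxE.
  transitivity ((map_poly f q).[t j] * t j ^+ i).
    by rewrite -eval_row_down; apply: eq_bigr => k _; rewrite mxE.
  by rewrite (eqP (qt j)) mul0r.
have drE i j : drsubmx (S *m W) i j = f (q * 'X^i)`_(m + j).
  rewrite 3!mxE big_split_ord /= big1 ?add0r => [|k _]; last first.
    by rewrite block_mxEur [(0 : 'M_(_, _)) _ _]mxE mulr0.
  rewrite (bigD1 j) //= block_mxEdr [1%:M _ _]mxE eqxx mulr1 big1 ?addr0.
    by rewrite [LHS]mxE row_down.
  by move=> k /negPf kj; rewrite block_mxEdr [1%:M _ _]mxE kj mulr0.
have drdet : \det (drsubmx (S *m W)) = 1.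
  rewrite det_trig => [|]; last first.
    apply/is_trig_mxP => i j ij; rewrite drE nth_default ?rmorph0 //.
    rewrite (leq_trans (size_polyMleq _ _)) // size_polyXn addnS /=.
    by rewrite -(prednK q0) addSn -/m -addnS leq_add2l.
  rewrite big1 // => i _; rewrite drE coefMXn ltnNge leq_addl /= addnK.
  by rewrite /m -lead_coefE (monicP q_monic) rmorph1.
apply: (mulIf V0); rewrite -{1}detW -det_map_mx -/S -det_mulmx.
rewrite -[S *m W]submxK dlE det_ublock drdet mulr1 ulE det_mulmx det_diag mulrC.
by congr (_ * _); apply: eq_bigr => i _; rewrite mxE.
Qed.

End ResultantRoots.

(** * The discriminant in terms of the roots *)

Section DiscriminantRoots.
Variables (R : comNzRingType) (K : fieldType) (f : {rmorphism R -> K}) (n : nat).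
Variables (q : {poly R}) (t : 'I_n -> K).
Hypotheses (q_monic : q \is monic) (q_split : map_poly f q = \prod_i ('X - (t i)%:P)).

Let size_q : size q = n.+1.
Proof.
have <- : size (map_poly f q) = size q.
  by rewrite size_map_poly_id0 // (monicP q_monic) rmorph1 oner_eq0.
by rewrite q_split size_prod_XsubC /index_enum -enumT size_enum_ord.
Qed.

Let root_t i : root (map_poly f q) (t i).
Proof. by rewrite q_split rootE horner_prod_XsubC. Qed.

Let deriv_t i : (map_poly f q^`()).[t i] = \prod_(j | j != i) (t i - t j).
Proof.
rewrite -deriv_map q_split (bigD1 i) //= derivM derivXsubC mul1r hornerD hornerM.
rewrite hornerXsubC subrr mul0r addr0 horner_prod.
by apply: eq_bigr => j _; rewrite hornerXsubC.
Qed.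

(** A repeated root is common to q and its derivative. Distinctness is settled first because
    [resultant_prod_roots] assumes it. *)
Lemma discriminant_neq0_inj : f (discriminant q) != 0 -> injective t.
Proof.
move=> d0 i j tij; apply: contraNeq d0 => ij.
rewrite /discriminant rmorphM /= (resultant_common_root (t := t i)) ?mulr0 //.
  by rewrite size_q /= (leq_ltn_trans _ (ltn_ord i)).
by rewrite rootE deriv_t (bigD1 j) 1?eq_sym //= tij subrr mul0r.
Qed.

Lemma discriminant_prod : injective t ->
  f (discriminant q) = (-1) ^+ 'C(n, 2) * \prod_i \prod_(j | j != i) (t i - t j).
Proof.
move=> t_inj; rewrite /discriminant rmorphM rmorphXn rmorphN1 size_q /=.
congr (_ * _).
rewrite (resultant_prod_roots _ size_q q_monic t_inj root_t).
by apply: eq_bigr => i _; exact: deriv_t.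
Qed.

End DiscriminantRoots.

Section VandermondeSquare.
Variables (K : comNzRingType) (n : nat).

(** The sign is left open, as [kappa_sq] is only needed up to sign. *)
Lemma prod_sub_sq (t : 'I_n -> K) :
  let V := \prod_(j < n) \prod_(i < n | (j < i)%N) (t j - t i) in
  let D := \prod_(j < n) \prod_(i < n | i != j) (t j - t i) in
  V ^+ 2 = D \/ V ^+ 2 = - D.
Proof.
move=> V D.
have -> : D = V * \prod_(j < n) \prod_(i < n | (i < j)%N) (t j - t i).
  rewrite -big_split; apply: eq_bigr => j _ /=.
  rewrite (bigID (fun i : 'I_n => (j < i)%N)) /=; congr (_ * _).
    by apply: eq_bigl => i; rewrite -val_eqE /=; case: ltngtP.
  by apply: eq_bigl => i; rewrite -val_eqE /=; case: ltngtP.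
rewrite (exchange_big_dep xpredT) //=.
have -> : \prod_(j < n) \prod_(i < n | (j < i)%N) (t i - t j) =
    (\prod_(j < n) \prod_(i < n | (j < i)%N) -1) * V.
  rewrite -big_split; apply: eq_bigr => j _ /=.
  rewrite -big_split; apply: eq_bigr => i _ /=.
  by rewrite mulN1r opprB.
pose pm (e : K) := e = 1 \/ e = -1.
have pm1 : pm 1 by left.
have pmM e1 e2 : pm e1 -> pm e2 -> pm (e1 * e2).
  by case=> ->; case=> ->; rewrite ?mulr1 ?mul1r ?mulrNN ?mulr1; [left|right|right|left].
have : pm (\prod_(j < n) \prod_(i < n | (j < i)%N) -1).
  by apply: (big_ind pm) => // j _; apply: (big_ind pm) => // i _; right.
by case=> ->; [left|right]; rewrite ?mul1r ?mulN1r ?mulrN ?opprK expr2.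
Qed.

End VandermondeSquare.

(** * The pairing as a sum over signed permutations of the roots *)

Section FieldEvaluation.
Variables (A : comNzRingType) (K : fieldType) (f : {rmorphism A -> K}) (n : nat).
Variables (ft : {poly A}) (w : 'I_n -> K).
Hypotheses (n_gt0 : (0 < n)%N) (ft_monic : ft \is monic).
Hypothesis size_ft : size ft = n.+1.
Hypothesis ft_split : map_poly f ft = \prod_i ('X - (w i ^+ 2)%:P).

Let D : A := (-1) ^+ n * 4%:R ^+ n * ft`_0 * discriminant ft.
Hypothesis D_neq0 : f D != 0.
Let t i := w i ^+ 2.

Let ft0E : f ft`_0 = (-1) ^+ n * \prod_i t i.
Proof.
rewrite -coef_map -horner_coef0 ft_split horner_prod.
rewrite (eq_bigr (fun i => - t i)) => [|i _]; last by rewrite hornerXsubC sub0r.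
by rewrite prodrN card_ord.
Qed.

Let t_inj : injective t.
Proof.
apply: (discriminant_neq0_inj ft_monic ft_split).
by apply: contraNneq D_neq0 => E; rewrite /D rmorphM E mulr0.
Qed.

Let DE : f D = (-1) ^+ 'C(n, 2) * (4%:R ^+ n * \prod_i t i *
  \prod_(j < n) \prod_(i < n | i != j) (t j - t i)).
Proof.
rewrite /D rmorphM (discriminant_prod ft_monic ft_split t_inj) !rmorphM /= ft0E.
rewrite !rmorphXn rmorphN1 rmorph_nat.
transitivity ((-1) ^+ n * ((-1) ^+ n * (-1) ^+ 'C(n, 2)) * (4%:R ^+ n * (\prod_i t i) *
  \prod_(j < n) \prod_(i < n | i != j) (t j - t i))); first by rewrite /t; ring.
by rewrite signrMK.
Qed.

Let two_neq0 : (2%:R : K) != 0.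
Proof.
apply: contraNneq D_neq0 => E; rewrite DE.
have -> : 4%:R = 2%:R * 2%:R :> K by rewrite -natrM.
by rewrite E mul0r expr0n -[n == 0%N]negbK -lt0n n_gt0 !mul0r mulr0.
Qed.

Let w_neq0 i : w i != 0.
Proof.
apply: contraNneq D_neq0 => E; rewrite DE (bigD1 i) //= {1}/t E expr0n.
by rewrite mul0r mulr0 mul0r mulr0.
Qed.

Let dt_neq0 j : \prod_(i < n | i != j) (t j - t i) != 0.
Proof.
apply/prodf_neq0 => i ij; rewrite subr_eq0.
by apply: contraNneq ij => /t_inj ->.
Qed.

Local Notation signed_map := {ffun 'I_n -> 'I_n * bool}.

Definition signed_root (r : 'I_n * bool) : K := (-1) ^+ r.2 * w r.1.
(** The derivative of F at its root [signed_root r]. *)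
Let den (r : 'I_n * bool) : K :=
  2%:R * signed_root r * \prod_(i < n | i != r.1) (t r.1 - t i).

Let signed_root_sq r : signed_root r ^+ 2 = t r.1.
Proof. by rewrite exprMn sqrr_sign mul1r. Qed.

Let lagrange : \sum_j (\prod_(i < n | i != j) (t j - t i))^-1 *:
  (\prod_(i < n | i != j) ('X - (t i)%:P)) = 1.
Proof.
apply/eqP; rewrite -subr_eq0; apply: contraT => /(max_poly_roots (rs := codom t)) H.
have : (size (codom t) < n)%N.
  apply: leq_trans (H _ _) _.
  - apply/allP => _ /codomP[j ->].
    rewrite rootE hornerD hornerN hornerC horner_sum (bigD1 j) //=.
    have E : (\prod_(i < n | i != j) ('X - (t i)%:P)).[t j] =
        \prod_(i < n | i != j) (t j - t i).
      by rewrite horner_prod; apply: eq_bigr => i _; rewrite hornerXsubC.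
    rewrite hornerZ E mulVf ?dt_neq0 // big1 ?addr0 ?subrr // => i ij.
    have E0 : (\prod_(l < n | l != i) ('X - (t l)%:P)).[t j] = 0.
      by rewrite horner_prod (bigD1 j) 1?eq_sym //= hornerXsubC subrr mul0r.
    by rewrite hornerZ E0 mulr0.
  - by rewrite map_inj_uniq ?enum_uniq.
  apply: leq_trans (size_polyD _ _) _; rewrite size_polyN size_polyC oner_eq0.
  rewrite geq_max n_gt0 andbT; apply: leq_trans (size_sum _ _ _) _.
  apply/bigmax_leqP => j _; apply: leq_trans (size_scale_leq _ _) _.
  have mon : \prod_(i < n | i != j) ('X - (t i)%:P) \is monic.
    by apply: rpred_prod => i _; exact: monicXsubC.
  have : size (\prod_i ('X - (t i)%:P)) = n.+1.
    by rewrite size_prod_XsubC /index_enum -enumT size_enum_ord.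
  rewrite (bigD1 j) //= size_monicM ?monicXsubC ?monic_neq0 // size_XsubC.
  by rewrite add2n => -[->].
by rewrite size_codom card_ord ltnn.
Qed.

Let F_split (x : 'I_n -> K) : (forall i, x i ^+ 2 = t i) ->
  map_poly f (ft \Po 'X^2) = \prod_(i < n) ('X^2 - (x i ^+ 2)%:P).
Proof.
move=> xE; rewrite map_comp_poly map_polyXn ft_split -prod_comp_sq.
by apply: eq_bigr => i _; rewrite xE.
Qed.

(** Partial fractions: the coefficient of 1/u in u^k / F is the sum of xi^k / F'(xi) over the 2n
    roots xi. The proof substitutes u^2 in the Lagrange interpolation of 1 and writes 2 w_j G_j as
    the difference of the cofactors of w_j and -w_j. *)
Lemma residue_roots k :
  f (residue n ft k) = \sum_r (den r)^-1 * signed_root r ^+ k.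
Proof.
pose L k := f (residue n ft k).
pose G j : {poly K} := \prod_(i < n | i != j) ('X^2 - (t i)%:P).
have GE j : 2%:R * w j * poly_fun idfun L (G j * 'X^k) = w j ^+ k - (- w j) ^+ k.
  have E : (2%:R * w j) *: (G j * 'X^k) =
      ('X + (w j)%:P) * G j * 'X^k + (-1) *: (('X + (- w j)%:P) * G j * 'X^k).
    rewrite scaleN1r -mul_polyC polyCM polyCN; ring.
  transitivity (poly_fun idfun L ((2%:R * w j) *: (G j * 'X^k))).
    by rewrite poly_funZ.
  rewrite E poly_funD poly_funZ /= mulN1r.
  rewrite (residue_cofactor n_gt0 ft_monic size_ft (x := w) (F_split _)) //; congr (_ - _).
  rewrite -(residue_cofactor n_gt0 ft_monic size_ft (x := fun i => - w i) (F_split _)); last first.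
    by move=> i; rewrite sqrrN.
  by congr (poly_fun _ _ (_ * _ * _)); apply: eq_bigr => i _; rewrite sqrrN.
rewrite -[LHS](poly_funXn idfun L).
have -> : 'X^k = \sum_j (\prod_(i < n | i != j) (t j - t i))^-1 *: (G j * 'X^k).
  have E1 : 1 \Po 'X^2 = 1 :> {poly K} by exact: comp_polyC.
  rewrite -[LHS]mul1r -[X in X * _]E1 -lagrange raddf_sum mulr_suml.
  apply: eq_bigr => j _; rewrite /= comp_polyZ -scalerAl rmorph_prod /=.
  congr (_ *: (_ * _)); apply: eq_bigr => i _.
  by rewrite comp_polyB comp_polyX comp_polyC.
rewrite -(pair_bigA _ (fun i b => (den (i, b))^-1 * signed_root (i, b) ^+ k)) /=.
elim/big_rec2: _ => [|j y1 y2 _ IH]; first by rewrite /poly_fun size_poly0 big_ord0.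
rewrite poly_funD {}IH poly_funZ; congr (_ + _); rewrite big_bool /=.
apply: (mulfI (mulf_neq0 two_neq0 (w_neq0 j))); rewrite mulrCA GE /den /signed_root /=.
rewrite expr0 expr1 mul1r mulN1r.
by field; rewrite oppr_eq0 w_neq0 dt_neq0 two_neq0.
Qed.

Lemma tensor_fun_roots (h : {mpoly A[n]}) :
  f (tensor_fun idfun (fun=> residue n ft) h) =
  \sum_(s : signed_map)
     (\prod_j (den (s j))^-1) * mmap f (fun j => signed_root (s j)) h.
Proof.
elim/mpolyind: h => [|c m h _ _ IH].
  by rewrite !raddf0 big1 // => s _; rewrite raddf0 mulr0.
rewrite !raddfD /= IH tensor_funZX rmorphM rmorph_prod /=.
rewrite (eq_bigr (fun j => \sum_r (den r)^-1 * signed_root r ^+ m j)); last first.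
  by move=> j _; exact: residue_roots.
rewrite bigA_distr_bigA mulr_sumr -big_split; apply: eq_bigr => s _ /=.
rewrite mmapD mmapZ mmapX mulrDr big_split /=; congr (_ + _).
by rewrite mulrCA.
Qed.

Let kappa (s : signed_map) : K :=
  (\prod_j (den (s j))^-1) *
  \prod_(j < n) \prod_(i < n | (j < i)%N) (t (s j).1 - t (s i).1).

Lemma pairing_roots (h : {mpoly A[n]}) : f (pairing ft h) =
  \sum_(s : signed_map)
     kappa s * mmap f (fun j => signed_root (s j)) h.
Proof.
rewrite /pairing tensor_fun_roots; apply: eq_bigr => s _.
rewrite rmorphM mulrA; congr (_ * _ * _).
rewrite /sq_vander rmorph_prod; apply: eq_bigr => j _ /=.
rewrite rmorph_prod; apply: eq_bigr => i _ /=.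
by rewrite mmapB !rmorphXn /= !mmapX !mmap1U !signed_root_sq.
Qed.

(** Two variables sent to roots with the same square kill the Vandermonde factor, so only signed
    permutations survive. *)
Lemma kappa0 (s : signed_map) : ~ injective (fun j => (s j).1) -> kappa s = 0.
Proof.
move=> /injectiveP/injectivePn[i [j ij E]].
rewrite /kappa; suff -> : \prod_(j < n) \prod_(i < n | (j < i)%N)
   (t (s j).1 - t (s i).1) = 0 by rewrite mulr0.
wlog lt_ij : i j ij E / (i < j)%N.
  move=> H; have : (i != j :> nat) by [].
  by rewrite neq_ltn => /orP[/(H i j)|/(H j i)]; apply; rewrite // eq_sym.
by rewrite (bigD1 i) //= (bigD1 j) //= E subrr !mul0r.
Qed.

(** The product of the denominators has square 4^n T R^2, the Vandermonde factor has square +-R, and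
    Delta is +-4^n T R. *)
Lemma kappa_sq (s : signed_map) : injective (fun j => (s j).1) ->
  f D * kappa s ^+ 2 = 1 \/ f D * kappa s ^+ 2 = - 1.
Proof.
move=> s_inj; pose T := \prod_i t i.
pose R := \prod_(j < n) \prod_(i < n | i != j) (t j - t i).
have R0 : R != 0 by apply/prodf_neq0 => j _.
have T0 : T != 0 by apply/prodf_neq0 => j _; rewrite expf_neq0.
have RE : \prod_(j < n) \prod_(i < n | i != j) (t (s j).1 - t (s i).1) = R.
  rewrite /R [RHS](reindex_inj s_inj); apply: eq_bigr => j _ /=.
  rewrite [RHS](reindex_inj s_inj); apply: eq_bigl => i /=.
  by rewrite (inj_eq s_inj).
have denE : (\prod_j (den (s j))^-1) ^+ 2 = (4%:R ^+ n * T * R ^+ 2)^-1.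
  rewrite prodfV exprVn /den 2!big_split /= 2!exprMn; congr (_ * _ * _)^-1.
  - by rewrite prodr_const card_ord exprAC -(natrX K 2 2).
  - rewrite -prodrXl /T [RHS](reindex_inj s_inj); apply: eq_bigr => j _.
    exact: signed_root_sq.
  - by congr (_ ^+ 2); rewrite /R [RHS](reindex_inj s_inj).
have four0 : 4%:R != 0 :> K by rewrite (natrM K 2 2) mulf_neq0.
have nz : 4%:R ^+ n * T * R != 0 by rewrite !mulf_neq0 ?expf_neq0.
have sgn : ((-1) ^+ 'C(n, 2) = 1 :> K) \/ ((-1) ^+ 'C(n, 2) = -1 :> K).
  by rewrite -signr_odd; case: odd; [right|left].
have main (e : K) : f D * ((4%:R ^+ n * T * R ^+ 2)^-1 * (e * R)) = (-1) ^+ 'C(n, 2) * e.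
  by rewrite DE -/T -/R; field; rewrite T0 R0 expf_neq0.
rewrite /kappa exprMn denE.
have [] := prod_sub_sq (fun j => t (s j).1) => /= ->; rewrite RE.
  by have := main 1; rewrite mul1r mulr1 => ->.
have := main (-1); rewrite mulN1r mulrN1 => ->; case: sgn => ->; [by right|by left; rewrite opprK].
Qed.

(** The square of this element is the product of Delta kappa(s)^2 and Delta kappa(s')^2, each being
    0, 1 or -1. *)
Lemma kappa_integral (s s' : signed_map) : integralOver f (f D * (kappa s * kappa s')).
Proof.
have pm_int (e : K) : e = 0 \/ e = 1 \/ e = -1 -> integralOver f e.
  case=> [->|[->|->]]; [exact: integral0|exact: integral1|].
  exact/integral_opp/integral1.
have k2 (s1 : signed_map) : f D * kappa s1 ^+ 2 = 0 \/ f D * kappa s1 ^+ 2 = 1 \/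
    f D * kappa s1 ^+ 2 = -1.
  have [/kappa_sq|/kappa0 ->] := pselect (injective (fun j => (s1 j).1)); first by right.
  by left; rewrite expr0n mulr0.
pose u := f D * (kappa s * kappa s').
have uE : u ^+ 2 = (f D * kappa s ^+ 2) * (f D * kappa s' ^+ 2).
  by rewrite /u; ring.
apply: (@integral_root_monic _ _ _ _ ('X^2 - (u ^+ 2)%:P)).
- exact: monicXnsubC.
- by rewrite rootE hornerD hornerN hornerXn hornerC subrr.
apply/integral_poly => i; rewrite coefB coefXn coefC.
apply: integral_sub; first exact: integral_nat.
case: eqP => _; last exact: integral0.
by rewrite uE; apply: integral_mul; apply: pm_int; exact: k2.
Qed.

(** Once the square of the sum of the kappa(s) z(s) is expanded, the single factor Delta makes each
    product kappa(s) kappa(s') integral. *)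
Lemma pairing_integral (h : {mpoly A[n]}) (c : K) :
  (forall s : signed_map, injective (fun j => (s j).1) ->
     integralOver f (mmap f (fun j => signed_root (s j)) h / c)) ->
  integralOver f (f D * (f (pairing ft h) / c) ^+ 2).
Proof.
move=> hint; pose z (s : signed_map) := mmap f (fun j => signed_root (s j)) h / c.
have PR : f (pairing ft h) / c = \sum_(s : signed_map) kappa s * z s.
  by rewrite pairing_roots mulr_suml; apply: eq_bigr => s _; rewrite mulrA.
have {}hint (s : signed_map) : injective (fun j => (s j).1) -> integralOver f (z s) := hint s.
clearbody z.
have int_sum (I : finType) (g : I -> K) :
    (forall i, integralOver f (g i)) -> integralOver f (\sum_i g i).
  move=> gint; apply: (big_ind (integralOver f)) => [|x y|i _] //.
    exact: integral0.
  exact: integral_add.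
have -> : f D * (f (pairing ft h) / c) ^+ 2 =
    \sum_(s : signed_map) \sum_(s' : signed_map)
      f D * (kappa s * kappa s') * (z s * z s').
  rewrite PR expr2 mulr_suml mulr_sumr.
  apply: eq_bigr => s _; rewrite !mulr_sumr; apply: eq_bigr => s' _; ring.
apply: (int_sum _ _) => s; apply: (int_sum _ _) => s'.
have [s_inj|/kappa0 ->] := pselect (injective (fun j => (s j).1)); last first.
  by rewrite mul0r mulr0 mul0r; exact: integral0.
have [s'_inj|/kappa0 ->] := pselect (injective (fun j => (s' j).1)); last first.
  by rewrite !mulr0 mul0r; exact: integral0.
by apply: integral_mul; [exact: kappa_integral|apply: integral_mul; exact: hint].
Qed.

Lemma pairing_eq0 (h : {mpoly A[n]}) :
  (forall s : signed_map, injective (fun j => (s j).1) ->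
     mmap f (fun j => signed_root (s j)) h = 0) -> f (pairing ft h) = 0.
Proof.
move=> h0; rewrite pairing_roots big1 // => s _.
have [s_inj|/kappa0 ->] := pselect (injective (fun j => (s j).1)).
  by rewrite h0 ?mulr0.
by rewrite mul0r.
Qed.

Lemma signed_root_split (s : signed_map) :
  injective (fun j => (s j).1) -> map_poly f (ft \Po 'X^2) =
  \prod_(i < n) ('X^2 - (signed_root (s i) ^+ 2)%:P).
Proof.
move=> s_inj; rewrite (F_split (fun=> erefl)) (reindex_inj s_inj).
by apply: eq_bigr => i _; rewrite signed_root_sq.
Qed.

End FieldEvaluation.

(** * Construction of a splitting field *)

Lemma field_of_invertible (T : comNzRingType) :
  (forall x : T, x != 0 -> exists y, y * x = 1) ->
  exists (K : fieldType) (g : {rmorphism T -> K}), injective g.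
Proof.
move=> Tinv.
pose inv (x : T) : T :=
  if pselect (x != 0) is left nz then projT1 (cid (Tinv x nz)) else 0.
have mulVx : forall x : T, x != 0 -> inv x * x = 1.
  move=> x nz; rewrite /inv; case: pselect => // nz'.
  exact: projT2 (cid (Tinv x nz')).
have inv0 : inv 0 = 0.
  by rewrite /inv; case: pselect => // nz; case/eqP: (nz).
pose K : fieldType := HB.pack T (GRing.ComNzRing_isField.Build T mulVx inv0).
exists K, (idfun : {rmorphism T -> K}).
by move=> x y.
Qed.

Lemma prime_fraction_field (A : comNzRingType) (p : spec A) : local_domain p ->
  exists (K : fieldType) (g : {rmorphism A -> K}),
  forall a, g a = 0 <-> locker p a.
Proof.
move=> dom; pose D := loc_at p; pose T := total_frac D.
have /local_domainP Ddom := dom.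
have [x x0|K [g g_inj]] := @field_of_invertible T.
  have [a [s sreg xE]] := loc_fracP x.
  have areg : GRing.lreg a.
    move=> y z /eqP; rewrite -subr_eq0 -mulrBr => /eqP/Ddom/orP[/eqP a0|]; last first.
      by rewrite subr_eq0 => /eqP.
    have [v sv] := loc_map_inv (S := regulars D) sreg.
    case/negP: x0; rewrite -[x]mulr1 -sv mulrA xE a0 rmorph0 mul0r //.
  have [v av] := loc_map_inv (S := regulars D) areg.
  by exists (loc_map (regulars D) s * v); rewrite mulrC mulrA xE.
exists K, (g \o loc_map (regulars D) \o loc_map (prime_compl p)).
move=> a; rewrite /= -loc_at_eq0.
split=> [/eqP|->]; last by rewrite !rmorph0.
rewrite -(rmorph0 g) (inj_eq g_inj) => /eqP/loc_map_eq0[u ureg E].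
by apply: ureg; rewrite E mulr0.
Qed.

Lemma irreducible_factor (K : fieldType) (p : {poly K}) : (1 < size p)%N ->
  exists2 q, irreducible_poly q & q %| p.
Proof.
move=> p1; pose Q k := `[< exists q : {poly K}, [/\ q %| p, (1 < size q)%N & size q = k] >].
have exQ : exists k, Q k by exists (size p); apply/asboolP; exists p.
have [k /asboolP[q [qp q1 qk]] kmin] := ex_minnP exQ.
exists q => //; split=> // d d1 dq.
have q0 : q != 0 by rewrite -size_poly_gt0 ltnW.
have d0 : d != 0 by apply: contraNneq q0 => d0; move: dq; rewrite d0 dvd0p.
rewrite -dvdp_size_eqp // eqn_leq dvdp_leq //= qk; apply: kmin.
apply/asboolP; exists d; split=> //; first exact: dvdp_trans qp.
by move: d1; rewrite neq_ltn ltnS leqn0 size_poly_eq0 (negPf d0).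
Qed.

Lemma splitting_extension (K : fieldType) (p : {poly K}) : p \is monic ->
  exists (L : fieldType) (g : {rmorphism K -> L}) (rs : seq L),
    map_poly g p = \prod_(r <- rs) ('X - r%:P).
Proof.
move: {2}(size p) (leqnn (size p)) => m; elim: m K p => [|m IH] K p pm pmon.
  by move: pm; rewrite leqn0 size_poly_eq0 (negPf (monic_neq0 pmon)).
have [p1|p1] := leqP (size p) 1.
  exists K, idfun, [::]; rewrite big_nil map_poly_id //.
  by move/monicP: pmon; rewrite [p](size1_polyC p1) lead_coefC => ->.
have [q qirr qp] := irreducible_factor p1.
have [L _ [z qz _]] := irredp_FAdjoin qirr.
have : root (map_poly (GRing.in_alg L) p) z.
  by apply: root_dvdp qz; rewrite dvdp_map.
case/factor_theorem => p' pE.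
have mon' : p' \is monic.
  by rewrite -(monicMr _ (monicXsubC z)) -pE monic_map.
have [|L' [g [rs rsE]]] := IH L p' _ mon'.
  rewrite -ltnS; apply: leq_trans pm.
  rewrite -(size_map_poly (GRing.in_alg L)) pE size_Mmonic ?monicXsubC ?monic_neq0 //.
  by rewrite size_XsubC addn2.
exists L', (g \o GRing.in_alg L), (rcons rs (g z)).
rewrite map_poly_comp pE rmorphM /= rsE rmorphB /= map_polyX map_polyC /=.
by rewrite -cats1 big_cat big_seq1.
Qed.

(** After [ft] is split with roots t, the product of the X^2 - t is split too. If some t had no
    square root, X^2 - t would be coprime to all linear factors of a product that it divides. *)
Lemma splitting_field_sq (A : comNzRingType) (K : fieldType) (f : {rmorphism A -> K})
    n (ft : {poly A}) : ft \is monic -> size ft = n.+1 ->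
  exists (L : fieldType) (g : {rmorphism K -> L}) (w : 'I_n -> L),
    map_poly (g \o f) ft = \prod_i ('X - (w i ^+ 2)%:P).
Proof.
move=> ft_monic size_ft.
have [L1 [g1 [ts tsE]]] := splitting_extension (monic_map f ft_monic).
have mon2 : \prod_(t <- ts) ('X^2 - t%:P) \is monic.
  by apply: rpred_prod => t _; exact: monicXnsubC.
have [L2 [g2 [rs rsE]]] := splitting_extension mon2.
have size_ts : size ts = n.
  have : size (map_poly g1 (map_poly f ft)) = n.+1.
    rewrite size_map_poly size_map_poly_id0 ?size_ft //.
    by rewrite (monicP ft_monic) rmorph1 oner_eq0.
  by rewrite tsE size_prod_XsubC => -[].
have sq (i : 'I_n) : exists w : L2, g2 ts`_i = w ^+ 2.
  apply: contrapT => no.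
  pose q : {poly L2} := 'X^2 - (g2 ts`_i)%:P.
  have q_dvd : q %| \prod_(r <- rs) ('X - r%:P).
    rewrite -rsE rmorph_prod (big_nth 0) big_mkord.
    have i_ts : (i < size ts)%N by rewrite size_ts.
    rewrite (bigD1 (Ordinal i_ts)) //= rmorphB /= map_polyXn map_polyC.
    exact: dvdp_mulr.
  have q_cop : coprimep q (\prod_(r <- rs) ('X - r%:P)).
    elim: (rs) => [|r s IH]; first by rewrite big_nil coprimep1.
    rewrite big_cons coprimepMr IH andbT coprimep_XsubC; apply/negP => qr.
    apply: no; exists r; move: qr; rewrite rootE hornerD hornerN hornerXn hornerC.
    by rewrite subr_eq0 => /eqP.
  have : size q == 1%N.
    move: q_cop; rewrite /coprimep => /eqP <-; apply/eqP/esym/eqp_size.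
    by rewrite dvdp_gcd_idl.
  by rewrite size_XnsubC.
have [w wE] := choice sq.
exists L2, (g2 \o g1), w.
have -> : map_poly ((g2 \o g1) \o f) ft = map_poly g2 (map_poly g1 (map_poly f ft)).
  by rewrite -!map_poly_comp.
rewrite tsE rmorph_prod (big_nth 0) big_mkord size_ts; apply: eq_bigr => i _.
by rewrite rmorphB /= map_polyX map_polyC /= wE.
Qed.

(** * Normality of the splitting ring *)

Lemma nonzero_ring (T : comPzRingType) : (1 : T) <> 0 ->
  exists (S : comNzRingType) (g : {rmorphism T -> S}), bijective g.
Proof.
move=> /eqP T1.
pose S : comNzRingType := HB.pack T (GRing.PzSemiRing_isNonZero.Build T T1).
exists S, (idfun : {rmorphism T -> S}).
by exists idfun.
Qed.

Lemma splitting_ideal_ker (A T : comNzRingType) n (F : {poly A})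
    (G : {rmorphism {mpoly A[n]} -> T}) h :
  map_poly (G \o @mpolyC n A) F = \prod_(i < n) ('X^2 - (G 'X_i ^+ 2)%:P) ->
  ideal_set (splitting_ideal n F) h -> G h = 0.
Proof.
move=> GF /(_ [set h | G h = 0]); apply; split=> [|_ [k _ <-] /=].
  split=> [|x y /= Ex Ey|a x /= Ex] /=; first exact: rmorph0.
    by rewrite rmorphD Ex Ey addr0.
  by rewrite rmorphM Ex mulr0.
rewrite -(coef_map G) rmorphB rmorph_prod /= -map_poly_comp GF.
rewrite [X in _ - X](_ : _ = \prod_(i < n) ('X^2 - (G 'X_i ^+ 2)%:P)).
  by rewrite subrr coef0.
by apply: eq_bigr => i _; rewrite rmorphB /= map_polyXn map_polyC /= rmorphXn.
Qed.

(* Elements x of B need not be regular; but x v / c is idempotent in the total *)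
(* fraction ring, and idempotents are integral, hence lie in B_p.              *)
Section NormalityCriterion.
Variables (A : comNzRingType) (B : comPzRingType) (phi : {rmorphism A -> B}).
Variable q : spec B.
Let p := comap phi q.
Hypothesis torsion_free : forall c b, ~ locker p c -> phi c * b = 0 ->
  exists2 s, ~ prime_set p s & phi s * b = 0.
Hypothesis quasi_inverse : forall b, exists c w s, [/\ ~ locker p c,
  ~ prime_set p s & phi s * (phi c * b - b ^+ 2 * w) = 0].
Hypothesis integral_fraction : forall (c s0 : A) b m (g : nat -> B),
  ~ locker p c -> ~ locker p s0 -> g m = 1 ->
  phi s0 * (\sum_(i < m.+1) g i * b ^+ i * phi c ^+ (m - i)) = 0 ->
  exists s b', ~ prime_set p s /\ phi s * b = phi c * b'.

Lemma normal_domain_idempotent : normal_domain (loc_at q).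
Proof.
have lockB s b c : ~ prime_set q (phi s) -> ~ locker p c ->
    phi s * (phi c * b) = 0 -> locker q b.
  move=> qs cN; rewrite mulrCA => /(torsion_free cN)[t qt E].
  exists (phi t * phi s); first exact: nspecM.
  by rewrite -mulrA.
have psN s : ~ prime_set p s -> ~ locker p s by move=> ps /locker_sub.
have lock1 b c : ~ locker p c -> phi c * b = 0 -> locker q b.
  move=> cN E; apply: (lockB 1 b c) => //; first by rewrite rmorph1; exact: spec1.
  by rewrite E mulr0.
(* e / s is the idempotent of the total fraction ring supporting x *)
have idempotent x : exists c v s e, [/\ ~ locker p c, ~ prime_set p s,
    phi s * (x * v) = phi c * e & locker q ((phi s - e) * x)].
  have [c [v [s1 [cN ps1 E1]]]] := quasi_inverse x.
  (* The coefficients are those of T^2 - T, which has x v / c as a root because c x = x^2 v up to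
     s1. *)
  have [|s [e [ps E]]] := @integral_fraction c s1 (x * v) 2
      (fun i => if i == 2%N then 1 else if i == 1%N then -1 else 0) cN (psN _ ps1) erefl.
    rewrite !big_ord_recl big_ord0 /= /bump /= !subSS !subn0 ?subnn.
    transitivity (- v * (phi s1 * (phi c * x - x ^+ 2 * v))); last by rewrite E1 mulr0.
    ring.
  exists c, v, s, e; split=> //; apply: (lockB s1 _ c) => //.
  transitivity (phi s1 * (phi s * phi c * x - x * (phi c * e))); first by ring.
  rewrite -E; transitivity (phi s * (phi s1 * (phi c * x - x ^+ 2 * v))); first by ring.
  by rewrite E1 mulr0.
apply/normal_domain_locP; split=> [x0 y [u qu uxy]|a b bN [m [g [gm [u qu rel]]]]].
  pose x := u * x0.
  have {uxy}xy : x * y = 0 by rewrite -mulrA.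
  suff : locker q x \/ locker q y.
    by case; [move/(locker_cancel qu); left|right].
  have [c [v [s [e [cN ps E L]]]]] := idempotent x.
  (* B_q is local, so e or s - e is a unit there. If s - e is, then x vanishes; if e is, then c e y
     = s v x y = 0 makes y vanish. *)
  have [qe|qe] := pselect (prime_set q e); [left|right].
    apply: locker_cancel L => qse; apply: ps.
    by change (prime_set q (phi s)); rewrite -[phi s](subrK e); exact: specD.
  apply: (locker_cancel qe); apply: (lock1 _ c) => //.
  rewrite mulrA -E; transitivity (phi s * v * (x * y)); first by ring.
  by rewrite xy mulr0.
have [c [v [s [e [cN ps E L]]]]] := idempotent b.
have qe : ~ prime_set q e.
  move=> qe; apply: bN; apply: locker_cancel L => qse; apply: ps.
  by change (prime_set q (phi s)); rewrite -[phi s](subrK e); exact: specD.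
case: m => [|m] in gm rel *.
  case: (nspecM qu gm); move: rel; rewrite big_ord1 !expr0 !mulr1 => ->.
  exact: spec0.
(* As b v = c e / s, the fraction s a v / c equals e (a / b), with denominator c from A. Multiplying
   it by the leading coefficient u g_(m+1) gives [h / c], which satisfies a monic equation with
   coefficients [G]. *)
pose h := u * g m.+1 * (phi s * a * v).
pose G i := if i == m.+1 then 1 else g i * u * (u * g m.+1) ^+ (m - i) * e ^+ (m.+1 - i).
have [||s4 [b4 [ps4 E4]]] := @integral_fraction c 1 h m.+1 G cN (psN _ (@spec1 _ p)).
- by rewrite /G eqxx.
- rewrite rmorph1 mul1r.
  transitivity ((u * g m.+1) ^+ m * (phi s * v) ^+ m.+1 *
      (u * \sum_(i < m.+2) g i * a ^+ i * b ^+ (m.+1 - i))); last by rewrite rel mulr0.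
  rewrite !mulr_sumr; apply: eq_bigr => i _.
  have Eb : phi s * v * b = e * phi c by rewrite mulrAC -mulrA E mulrC.
  rewrite (expr_split_ord (phi s * v) i).
  transitivity ((u * g m.+1) ^+ m * u * g i * (phi s * a * v) ^+ i *
    (e * phi c) ^+ (m.+1 - i)); last first.
    by rewrite -Eb !exprMn; ring.
  rewrite /G /h; case: eqP => [->|im].
    by rewrite subnn !expr0 !mulr1 mul1r exprMn exprSr; ring.
  have im' : (i < m.+1)%N by rewrite ltn_neqAle -ltnS ltn_ord andbT; exact/eqP.
  by rewrite (expr_split_ord (u * g m.+1) (Ordinal im')) /= !exprMn; ring.
exists b4, (phi s4 * u * g m.+1 * e); first by do 3?apply: nspecM.
apply: (lock1 _ c) => //.
transitivity (phi s4 * u * g m.+1 * a * (phi c * e) - phi c * b4 * b); first by ring.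
by rewrite -E -E4 /h; ring.
Qed.

End NormalityCriterion.

(** * The splitting ring at a prime q, over the prime p of A *)

Section SplittingAtPrime.
Variables (A : comNzRingType) (n : nat) (ft : {poly A}).
Hypotheses (n_gt0 : (0 < n)%N) (ft_monic : ft \is monic).
Hypothesis size_ft : size ft = n.+1.
Let F := ft \Po 'X^2.
Let B := SSplit n F.
Let psi : {rmorphism {mpoly A[n]} -> B} := quo_map (splitting_ideal n F).
Let phi : {rmorphism A -> B} := SSplit_map n F.
Variable q : spec B.
Let p := comap phi q.
Let D : A := (-1) ^+ n * 4%:R ^+ n * ft`_0 * discriminant ft.

Let psiK b : exists h, b = psi h.
Proof. by exists (repr b); rewrite /psi /= /quo_map reprK. Qed.

Let psi0 h : psi h = 0 <-> ideal_set (splitting_ideal n F) h.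
Proof.
rewrite -(rmorph0 psi); split=> [/quo_eqE|Ih]; first by rewrite subr0.
by apply/quo_eqE; rewrite subr0.
Qed.

Let psiC c : psi c%:MP = phi c. Proof. by []. Qed.
Let psiZ c h : psi (c *: h) = phi c * psi h.
Proof. by rewrite -mul_mpolyC rmorphM. Qed.

(* B is only known to be a comPzRingType; polynomials over it, hence            *)
(* pairing_reproducing and integralOver, need the copy S of B.                  *)
Let nonzero_copy : exists (S : comNzRingType) (g : {rmorphism B -> S}) (x : 'I_n -> S),
  [/\ bijective g, forall h, g (psi h) = mmap (g \o phi) x h &
      map_poly (g \o phi) F = \prod_(i < n) ('X^2 - (x i ^+ 2)%:P)].
Proof.
have B1 : (1 : B) <> 0 by move=> E; apply: (@spec1 _ q); rewrite E; exact: spec0.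
have [S [g g_bij]] := nonzero_ring B1.
exists S, g, (fun i => g (Defs.eta F i)); split=> // [h|].
  elim/mpolyind: h => [|c m h _ _ IH]; first by rewrite !raddf0.
  rewrite !raddfD /= IH mmapZ mmapX psiZ rmorphM /=; congr (_ * _ + _).
  rewrite mpolyXE_id !rmorph_prod; apply: eq_bigr => i _.
  by rewrite !rmorphXn.
apply/polyP => k; apply/eqP; rewrite -subr_eq0 -coefB; apply/eqP.
have gen : psi (map_poly (@mpolyC n A) F - \prod_(i < n) ('X^2 - (('X_i) ^+ 2)%:P))`_k = 0.
  by apply/psi0 => J [_ +]; apply; exists k.
transitivity (g (psi (map_poly (@mpolyC n A) F -
  \prod_(i < n) ('X^2 - (('X_i) ^+ 2)%:P))`_k)); last by rewrite gen rmorph0.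
rewrite -[RHS](coef_map (g \o psi)) rmorphB rmorph_prod /= -map_poly_comp.
apply: (congr1 (fun P : {poly S} => P`_k)); congr (_ - _); apply: eq_bigr => i _.
by rewrite rmorphB /= map_polyXn map_polyC /= !rmorphXn.
Qed.

Let combine (c : A) h :
  (forall m, exists s e, ~ prime_set p s /\ s * pairing ft ('X_[m] * h) = c * e) ->
  exists s b, ~ prime_set p s /\ phi s * psi h = phi c * b.
Proof.
move=> /choice[s /choice[e se]].
have [S [g [x [g_bij gpsi F_split]]]] := nonzero_copy.
have [ginv _ gK] := g_bij.
pose Th := dual_kernel x; pose s0 := \prod_(m <- msupp Th) s m.
pose e0 m := e m * \prod_(m1 <- rem m (msupp Th)) s m1.
exists s0, (ginv (\sum_(m <- msupp Th) Th@_m * g (phi (e0 m)))); split.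
  apply: (big_ind (fun y => ~ prime_set p y)); first exact: spec1.
    exact: nspecM.
  by move=> m _; case: (se m).
apply: (bij_inj g_bij); rewrite !rmorphM gK gpsi.
rewrite (pairing_reproducing n_gt0 ft_monic size_ft F_split) !mulr_sumr.
apply: eq_big_seq => m mTh; rewrite mulrCA [RHS]mulrCA -!rmorphM /=; congr (_ * g (phi _)).
rewrite /s0 (perm_big _ (perm_to_rem mTh)) big_cons /e0 mulrA; case: (se m) => _ <-.
by rewrite mulrAC.
Qed.

Let torsion_free (c : A) b : local_domain p -> ~ locker p c -> phi c * b = 0 ->
  exists2 s, ~ prime_set p s & phi s * b = 0.
Proof.
move=> dom cN; have [h ->] := psiK b; rewrite -psiZ => /psi0 Ich.
have [m|s [b' [ps E]]] := combine (c := 0) (h := h).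
  have E : c * pairing ft ('X_[m] * h) = 0.
    rewrite -(pairing_splitting_ideal ft_monic size_ft 'X_[m] Ich) /pairing.
    by rewrite -scalerAl -scalerAr tensor_funZ /= [h * _]mulrC.
  have [|//|[s ps sE]] := dom c (pairing ft ('X_[m] * h)).
    by rewrite E; exact: locker0.
  by exists s, 0; rewrite mulr0.
by exists s; rewrite // E rmorph0 mul0r.
Qed.

Variables (K : fieldType) (f : {rmorphism A -> K}) (w : 'I_n -> K).
Hypothesis ker_f : forall a, f a = 0 <-> locker p a.
Hypothesis ft_split : map_poly f ft = \prod_i ('X - (w i ^+ 2)%:P).
Hypothesis D_neq0 : f D != 0.

Let dom : local_domain p.
Proof.
move=> a b /ker_f/eqP; rewrite rmorphM mulf_eq0.
by move=> /orP[]/eqP/ker_f; [left|right].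
Qed.

Let conj_eval (s : {ffun 'I_n -> 'I_n * bool}) : {rmorphism {mpoly A[n]} -> K} :=
  mmap f (fun j => signed_root w (s j)).

Let injective_index (s : {ffun 'I_n -> 'I_n * bool}) := injective (fun j => (s j).1).

Let conj_eval_C s c : conj_eval s c%:MP = f c.
Proof. exact: mmapC. Qed.

Let conj_eval0 s h : injective_index s -> psi h = 0 -> conj_eval s h = 0.
Proof.
move=> s_inj /psi0; apply: splitting_ideal_ker.
rewrite [LHS](_ : _ = map_poly f F); last first.
  by apply: eq_map_poly => c; exact: conj_eval_C.
rewrite (signed_root_split ft_split s_inj); apply: eq_bigr => i _.
by rewrite /conj_eval /= mmapX mmap1U.
Qed.

Let conj_eval_integral s h : injective_index s -> integralOver f (conj_eval s h).
Proof.
move=> s_inj; elim/mpolyind: h => [|c m h _ _ IH].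
  by rewrite rmorph0; exact: integral0.
rewrite rmorphD; apply: integral_add => //.
rewrite -mul_mpolyC rmorphM conj_eval_C; apply: integral_mul; first exact: integral_id.
rewrite mpolyXE_id rmorph_prod; apply: (big_ind (integralOver f)).
- exact: integral1.
- exact: integral_mul.
move=> i _; rewrite rmorphXn.
have xint : integralOver f (conj_eval s 'X_i).
  exists F; first exact: (comp_sq_monic ft_monic size_ft).
  rewrite (signed_root_split ft_split s_inj) rootE horner_prod (bigD1 i) //=.
  by rewrite hornerD hornerN hornerXn hornerC mmapX mmap1U subrr mul0r.
elim: (m i) => [|k IHk]; first exact: integral1.
by rewrite exprS; exact: integral_mul.
Qed.

(** If all conjugates of h are zero, so are all its pairings in K, and [combine] applies with c =
    0. *)
Let vanishing h : (forall s, injective_index s -> conj_eval s h = 0) ->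
  exists2 s, ~ prime_set p s & phi s * psi h = 0.
Proof.
move=> h0; have [m|s [b' [ps E]]] := combine (c := 0) (h := h).
  have /ker_f[s ps E] : f (pairing ft ('X_[m] * h)) = 0.
    apply: (pairing_eq0 n_gt0 ft_monic size_ft ft_split D_neq0) => s s_inj.
    by rewrite [LHS](rmorphM (conj_eval s)) h0 // mulr0.
  by exists s, 0; rewrite mulr0.
by exists s; rewrite // E rmorph0 mul0r.
Qed.

Hypotheses (noethA : noetherian A) (normA : normal_ring A) (sqf : squarefree D).

(** The conjugates of h / c are integral over A, hence so is Delta times the square of each pairing
    divided by c. Squarefreeness puts these quotients in A_p, and [combine] divides h by c. *)
Let integral_fraction (c s0 : A) b m (g : nat -> B) :
  ~ locker p c -> ~ locker p s0 -> g m = 1 ->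
  phi s0 * (\sum_(i < m.+1) g i * b ^+ i * phi c ^+ (m - i)) = 0 ->
  exists s b', ~ prime_set p s /\ phi s * b = phi c * b'.
Proof.
have [h ->] := psiK b; have [G GE] := choice (fun i => psiK (g i)).
move=> cN s0N gm rel.
have fc : f c != 0 by apply/eqP => /ker_f.
have fs0 : f s0 != 0 by apply/eqP => /ker_f.
apply: combine => k; pose d := pairing ft ('X_[k] * h).
have dint : integralOver f (f D * (f d / f c) ^+ 2).
  apply: (pairing_integral n_gt0 ft_monic size_ft ft_split D_neq0) => s s_inj.
  rewrite [mmap _ _ _](rmorphM (conj_eval s)) -mulrA.
  apply: integral_mul; first exact: conj_eval_integral.
  (* [G m] lifts 1 only modulo the splitting ideal; replacing it by 1 makes Q visibly monic. *)
  pose Q := \poly_(i < m.+1) conj_eval s (if i == m then 1 else G i).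
  apply: (@integral_root_monic _ _ _ _ Q).
  - rewrite monicE lead_coef_poly //= eqxx rmorph1 ?oner_neq0 //.
  - rewrite rootE horner_poly; apply/eqP.
    apply: (mulfI (expf_neq0 m fc)); apply: (mulfI fs0); rewrite !mulr0.
    rewrite -[RHS](conj_eval0 (h := s0 *: \sum_(i < m.+1)
      (if i == m :> nat then 1 else G i) * h ^+ i * (c%:MP) ^+ (m - i)) s_inj).
      rewrite -mul_mpolyC rmorphM conj_eval_C rmorph_sum mulr_sumr; congr (_ * _).
      apply: eq_bigr => i _; rewrite !rmorphM !rmorphXn conj_eval_C /=.
      rewrite (expr_split_ord (f c) i) expr_div_n.
      by field; rewrite expf_neq0.
    rewrite psiZ rmorph_sum -[RHS]rel; congr (_ * _); apply: eq_bigr => i _.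
    rewrite !rmorphM !rmorphXn -psiC; congr (_ * _ * _).
    by case: eqP => [->|_]; rewrite ?gm ?rmorph1 -?GE.
  - apply/integral_poly => i; rewrite coef_poly; case: ifP => _; last exact: integral0.
    exact: conj_eval_integral.
have E : f D * (f d / f c) ^+ 2 = f (D * d ^+ 2) / f (c ^+ 2).
  by rewrite rmorphM !rmorphXn expr_div_n mulrA.
have : in_loc f p (f D * (f d / f c) ^+ 2).
  rewrite E; apply: (in_loc_integral normA ker_f) => //; first by rewrite rmorphXn expf_neq0.
  by rewrite -E.
move/(in_loc_squarefree noethA normA ker_f sqf fc) => [e [s [ps sE]]].
have /ker_f[s' ps' E'] : f (s * d - c * e) = 0.
  by rewrite rmorphB !rmorphM -sE /=; field.
exists (s' * s), (s' * e); split; first exact: nspecM.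
by apply/eqP; rewrite -subr_eq0 -mulrA [c * _]mulrCA -mulrBr E'.
Qed.

(** Let Q be a monic equation of b over A and Q_j its lowest coefficient nonzero in K, so that Q =
    X^j (Q_j + X R) over K. Each conjugate y of b is zero or satisfies Q_j + y R(y) = 0, hence Q_j y
    + y^2 R(y) = 0, and [vanishing] carries this relation back to b. *)
Let quasi_inverse b : exists c w s, [/\ ~ locker p c, ~ prime_set p s &
  phi s * (phi c * b - b ^+ 2 * w) = 0].
Proof.
have [h ->] := psiK b; have [S [g [x [g_bij gpsi F_split]]]] := nonzero_copy.
have [Q monQ rootQ] : integralOver (g \o phi) (g (psi h)).
  rewrite gpsi; elim/mpolyind: h => [|c m h _ _ IH]; first by rewrite raddf0; exact: integral0.
  rewrite mmapD; apply: integral_add => //; rewrite mmapZ mmapX.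
  apply: integral_mul; first exact: integral_id.
  apply: (big_ind (integralOver _)); [exact: integral1|exact: integral_mul|move=> i _].
  have xint : integralOver (g \o phi) (x i).
    exists F; first exact: (comp_sq_monic ft_monic size_ft).
    rewrite F_split rootE horner_prod (bigD1 i) //=.
    by rewrite hornerD hornerN hornerXn hornerC subrr mul0r.
  elim: (m i) => [|k IHk]; first exact: integral1.
  by rewrite exprS; exact: integral_mul.
have Qh : psi (map_poly (@mpolyC n A) Q).[h] = 0.
  apply: (bij_inj g_bij); rewrite rmorph0 -[RHS](eqP rootQ).
  by rewrite -[LHS](horner_map (g \o psi)) -map_poly_comp.
have exj : exists j, f Q`_j != 0.
  by exists (size Q).-1; rewrite -lead_coefE (monicP monQ) rmorph1 oner_neq0.
have [j jN jmin] := ex_minnP exj.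
pose R := \poly_(i < size Q) Q`_(i + j.+1).
have QE : map_poly f Q = 'X^j * ((f Q`_j)%:P + 'X * map_poly f R).
  apply/polyP => i; rewrite coefXnM coefD coefC coefXM !coef_map coef_poly.
  case: ltnP => [ij|ji].
    by apply/eqP; apply: contraTT ij => /jmin; rewrite -leqNgt.
  have [->|ij] := eqVneq i j; first by rewrite subnn /= addr0.
  have {ij}ji : (j < i)%N by rewrite ltn_neqAle eq_sym ij.
  have kE : ((i - j).-1 + j.+1 = i)%N by rewrite addnS -addSn prednK ?subn_gt0 // subnK // ltnW.
  rewrite subn_eq0 leqNgt ji /= add0r kE; case: ltnP => // sQ.
  by rewrite nth_default ?rmorph0 // (leq_trans sQ) // (leq_trans (leq_pred _)) // leq_subr.
pose h' := Q`_j *: h + h ^+ 2 * (map_poly (@mpolyC n A) R).[h].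
have [s s_inj|s ps E] := vanishing (h := h').
  pose y := conj_eval s h.
  have evP (P : {poly A}) : conj_eval s (map_poly (@mpolyC n A) P).[h] = (map_poly f P).[y].
    rewrite -horner_map -map_poly_comp; congr (_.[_]).
    by apply: eq_map_poly => c; exact: conj_eval_C.
  have : (map_poly f Q).[y] = 0 by rewrite -evP; exact: conj_eval0.
  rewrite QE hornerM hornerXn hornerD hornerC hornerM hornerX -/y => /eqP.
  rewrite /h' expr2 -mul_mpolyC rmorphD !rmorphM conj_eval_C evP -/y.
  rewrite mulf_eq0 expf_eq0 => /orP[/andP[_ /eqP ->]|/eqP y0]; first by rewrite mulr0 !mul0r addr0.
  transitivity (y * (f Q`_j + y * (map_poly f R).[y])); first by ring.
  by rewrite y0 mulr0.
exists Q`_j, (- psi (map_poly (@mpolyC n A) R).[h]), s; split=> //.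
  by move/ker_f/eqP; apply/negP.
by rewrite -[RHS]E /h' !expr2 rmorphD psiZ !rmorphM mulrN opprK.
Qed.

Lemma normal_at_splitting_prime : normal_domain (loc_at q).
Proof.
apply: (@normal_domain_idempotent _ _ phi); last exact: integral_fraction.
  by move=> c b; exact: torsion_free.
exact: quasi_inverse.
Qed.

End SplittingAtPrime.

Lemma tilde_poly_coef (A : comNzRingType) n (a : nat -> A) :
  tilde_poly n a = \poly_(i < n.+1) a (2 * n - 2 * i)%N.
Proof. by rewrite poly_def. Qed.

Theorem proposition2p5 (A : comNzRingType) (n : nat) (a : nat -> A)
    (f : {poly A})
    (noethA : noetherian A)
    (two_unit : exists h : A, 2%:R * h = 1)
    (n_gt0 : (1 <= n)%N)
    (a0 : a 0%N = 1)
    (fE : f = \sum_(i < n.+1) a (2 * n - 2 * i)%N *: 'X^(2 * i))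
    (A_normal : normal_ring A)
    (Delta_squarefree : squarefree (Delta n a))
    (Delta_regular : GRing.lreg (Delta n a))
    (E_codim : codim_ge (branch_image n f) 2) :
  normal_ring (SSplit n f).
Proof.
pose ft := tilde_poly n a.
have lead : a (2 * n - 2 * n)%N = 1 by rewrite subnn.
have size_ft : size ft = n.+1.
  by rewrite /ft tilde_poly_coef size_poly_eq // lead oner_neq0.
have ft_monic : ft \is monic.
  by rewrite monicE lead_coefE size_ft /ft tilde_poly_coef coef_poly ltnSn lead.
have fF : f = ft \Po 'X^2.
  rewrite fE /ft /tilde_poly rmorph_sum; apply: eq_bigr => i _.
  by rewrite /= comp_polyZ comp_Xn_poly -exprM.
have DE : Delta n a = (-1) ^+ n * 4%:R ^+ n * ft`_0 * discriminant ft.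
  by rewrite /Delta /ft {2}tilde_poly_coef coef_poly /= muln0 subn0.
rewrite {fE E_codim}fF => q.
have [dom _] := (normal_domain_locP _).1 (A_normal (comap (SSplit_map n (ft \Po 'X^2)) q)).
have [K0 [f0 ker_f0]] := prime_fraction_field dom.
have [K [g [w ft_split]]] := splitting_field_sq f0 ft_monic size_ft.
apply: (normal_at_splitting_prime n_gt0 ft_monic size_ft (f := g \o f0)) => //.
- by move=> c; rewrite -ker_f0 /=; split=> [/eqP|->]; rewrite ?rmorph0 // fmorph_eq0 => /eqP.
- exact: ft_split.
(* Being regular, Delta is annihilated by no element outside p, so its image in K is nonzero. *)
- rewrite -DE /= fmorph_eq0; apply/eqP => /ker_f0[s ps sD].
  have s0 : s = 0 by apply: Delta_regular; rewrite mulr0 mulrC.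
  by apply: ps; rewrite s0; exact: spec0.
- by rewrite -DE.
Qed.
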